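(* Let $\mathcal C,\mathcal D$ be unitary fusion categories and ${}_{\mathcal C}\mathcal M_{\mathcal D}$ an indecomposable finitely semisimple unitary bimodule category with $d^L_m=d^R_m$ for all $m\in\mathrm{Irr}(\mathcal M)$. If the endofunctor $\mathfrak f\in\mathrm{Fun}_{\mathcal C|\mathcal D}(\mathcal M,\mathcal M)$ is simple, then $V^{\mathfrak f}$ is an irreducible representation of $\mathbf{Tube}({}_{\mathcal C}\mathcal M_{\mathcal D})$.
   Context: $\mathrm{Fun}_{\mathcal C|\mathcal D}(\mathcal M,\mathcal M)$: bimodule endofunctors $\mathfrak f$, with structure isomorphisms $\mathfrak f(a\otimes m\otimes b)\cong a\otimes\mathfrak f(m)\otimes b$ (suppressed). Associators are suppressed. $\mathrm{Irr}$: representatives of simple objects. $d_a$ is the quantum dimension in a unitary fusion category; the left quantum dimensions $d^L_m>0$ satisfy $d_ad^L_m=\sum_n\dim\mathrm{Hom}(a\otimes m,n)d^L_n$ for $a\in \mathrm{Irr}(\mathcal C)$; the right ones $d^R_m>0$ satisfy $d^R_md_b=\sum_n\dim\mathrm{Hom}(m\otimes b,n)d^R_n$ for $b\in \mathrm{Irr}(\mathcal D)$ (up to overall scale). Domain wall tube algebra (as an algebra): $\mathbf{Tube}({}_{\mathcal C}\mathcal M_{\mathcal D})=\bigoplus_{a,b}\bigoplus_{x,z,u,w\in\mathrm{Irr}(\mathcal M)}\mathrm{Hom}(x,a\otimes z\otimes b)\otimes\mathrm{Hom}(a\otimes u\otimes b,w)$ ($a\in\mathrm{Irr}(\mathcal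 C),b\in\mathrm{Irr}(\mathcal D)$), with unit $1=\sum_{x,u}\mathrm{id}_x\otimes\mathrm{id}_u$ ($a=b=\mathbb 1$) and product, for $f\otimes g$ in summand $(a,b;x,z,u,w)$ and $f'\otimes g'$ in $(a',b';x',z',u',w')$, $(f\otimes g)(f'\otimes g')=\delta_{u,w'}\delta_{z,x'}\sum_{k,s}\sum_{\tau,\sigma}[(\tau^*\otimes\mathrm{id}_{z'}\otimes\sigma^* )(\mathrm{id}_a\otimes f'\otimes\mathrm{id}_b)f]\otimes[g(\mathrm{id}_a\otimes g'\otimes\mathrm{id}_b)(\tau\otimes\mathrm{id}_{u'}\otimes\sigma)]$, where $\tau,\tau^*$ are dual bases of $\mathrm{Hom}(k,a\otimes a')$, $\mathrm{Hom}(a\otimes a',k)$ (i.e. $\tau_i^*\tau_j=\delta_{ij}\mathrm{id}_k$), $k\in\mathrm{Irr}(\mathcal C)$, and $\sigma,\sigma^*$ are dual bases of $\mathrm{Hom}(s,b'\otimes b)$, $\mathrm{Hom}(b'\otimes b,s)$, $s\in\mathrm{Irr}(\mathcal D)$. Module: $V^{\mathfrak f}=\bigoplus_{x,y\in\mathrm{Irr}(\mathcal M)}\mathrm{Hom}(x,\mathfrak f(y))$ with action, for $\alpha\in\mathrm{Hom}(s,\mathfrak f(t))$: $(f\otimes g)\triangleright\alpha=\delta_{z,s}\delta_{u,t}\,\mathfrak f(g)\circ(\mathrm{id}_a\otimes\alpha\otimes\mathrm{id}_b)\circ f\in\mathrm{Hom}(x,\mathfrak f(w))$. *)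

(* Defs.v *)
From HB Require Import structures.
From mathcomp Require Import all_boot all_order all_algebra.
From mathcomp Require Import reals complex.

Set Implicit Arguments.
Unset Strict Implicit.
Unset Printing Implicit Defensive.

Import GRing.Theory Num.Theory.

Local Open Scope ring_scope.
Local Open Scope complex_scope.

Declare Scope cat_scope.
Delimit Scope cat_scope with cat.
Local Open Scope cat_scope.

Reserved Notation "f ^†" (at level 1, left associativity, format "f ^†").
Reserved Notation "x ⊗ y" (at level 35, right associativity).
Reserved Notation "f ⊗' g" (at level 35, right associativity).
Reserved Notation "a ▷ m" (at level 35, right associativity).
Reserved Notation "f ▷' g" (at level 35, right associativity).
Reserved Notation "m ◁ b" (at level 38, left associativity).
Reserved Notation "f ◁' g" (at level 38, left associativity).

Section DirectSum.
Variables (K : fieldType) (I : finType) (F : I -> vectType K).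

Definition dsum := {dffun forall i : I, F i}.
HB.instance Definition _ := Choice.on dsum.

Implicit Types s t : dsum.

Definition dsum0 : dsum := [ffun i => 0 : F i].
Definition dsum_opp s : dsum := [ffun i => - s i].
Definition dsum_add s t : dsum := [ffun i => s i + t i].
Definition dsum_scale (c : K) s : dsum := [ffun i => c *: s i].

Fact dsum_addA : associative dsum_add.
Proof. by move=> r s t; apply/ffunP=> i; rewrite !ffunE addrA. Qed.
Fact dsum_addC : commutative dsum_add.
Proof. by move=> s t; apply/ffunP=> i; rewrite !ffunE addrC. Qed.
Fact dsum_add0 : left_id dsum0 dsum_add.
Proof. by move=> s; apply/ffunP=> i; rewrite !ffunE add0r. Qed.
Fact dsum_addN : left_inverse dsum0 dsum_opp dsum_add.
Proof. by move=> s; apply/ffunP=> i; rewrite !ffunE addNr. Qed.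

HB.instance Definition _ :=
  GRing.isZmodule.Build dsum dsum_addA dsum_addC dsum_add0 dsum_addN.

Fact dsum_scaleA c d s : dsum_scale c (dsum_scale d s) = dsum_scale (c * d) s.
Proof. by apply/ffunP=> i; rewrite !ffunE scalerA. Qed.
Fact dsum_scale1 : left_id 1 dsum_scale.
Proof. by move=> s; apply/ffunP=> i; rewrite !ffunE scale1r. Qed.
Fact dsum_scaleDr : right_distributive dsum_scale +%R.
Proof. by move=> c s t; apply/ffunP=> i; rewrite !ffunE scalerDr. Qed.
Fact dsum_scaleDl s : {morph dsum_scale^~ s : c d / c + d}.
Proof. by move=> c d; apply/ffunP=> i; rewrite !ffunE scalerDl. Qed.

HB.instance Definition _ := GRing.Zmodule_isLmodule.Build K dsum
  dsum_scaleA dsum_scale1 dsum_scaleDr dsum_scaleDl.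

End DirectSum.

(** [V ⊗ W] is modelled by coordinate matrices in the bases [vbasis {:V}] and
    [vbasis {:W}]: [tpure v w] is the pure tensor [v ⊗ w], and [tlift B] is the
    linear map on [V ⊗ W] that a bilinear [B] induces. *)
Section Tensor.
Variable K : fieldType.
Variables V W : vectType K.

Definition tprod : vectType K := 'M[K]_(\dim {:V}, \dim {:W}).

Definition tpure (v : V) (w : W) : tprod :=
  \matrix_(i, j) (coord (vbasis {:V}) i v * coord (vbasis {:W}) j w).

Definition tlift (U : lmodType K) (B : V -> W -> U) (t : tprod) : U :=
  \sum_i \sum_j t i j *: B (vbasis {:V})`_i (vbasis {:W})`_j.

End Tensor.

Section Representations.
Variables (K : fieldType) (A V : lmodType K).
Variables (one : A) (mul : A -> A -> A) (act : A -> V -> V).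

Definition is_representation : Prop :=
  [/\ forall v, linear (act ^~ v),
      forall t, linear (act t),
      forall v, act one v = v
    & forall s t v, act (mul s t) v = act s (act t v)].

Definition is_invariant_subspace (W : V -> Prop) : Prop :=
  [/\ W 0,
      forall c v w, W v -> W w -> W (c *: v + w)
    & forall t v, W v -> W (act t v)].

Definition is_irreducible_representation : Prop :=
  [/\ is_representation,
      exists v : V, v <> 0
    & forall W, is_invariant_subspace W ->
        (forall v, W v -> v = 0) \/ (forall v, W v)].

End Representations.

Record dagger_category (R : realType) := DaggerCategory {
  ob :> Type;
  hom : ob -> ob -> vectType R[i];
  idm : forall x, hom x x;
  comp : forall x y z, hom y z -> hom x y -> hom x z;
  dag : forall x y, hom x y -> hom y x;
  comp_assoc : forall x y z w (h : hom z w) (g : hom y z) (f : hom x y),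
    comp h (comp g f) = comp (comp h g) f;
  comp_idl : forall x y (f : hom x y), comp (idm y) f = f;
  comp_idr : forall x y (f : hom x y), comp f (idm x) = f;
  comp_linl : forall x y z (f : hom x y), linear (fun g : hom y z => comp g f);
  comp_linr : forall x y z (g : hom y z), linear (fun f : hom x y => comp g f);
  dag_antilin : forall x y (c : R[i]) (f g : hom x y),
    dag (c *: f + g) = (c^*)%R *: dag f + dag g;
  dag_invol : forall x y (f : hom x y), dag (dag f) = f;
  dag_comp : forall x y z (g : hom y z) (f : hom x y),
    dag (comp g f) = comp (dag f) (dag g)
}.

Arguments hom {R d} x y.
Arguments idm {R d} x.
Arguments comp {R d x y z} g f.
Arguments dag {R d x y} f.

Notation "g \o f" := (comp g f) : cat_scope.
Notation "f ^†" := (dag f) : cat_scope.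

Section DaggerCategoryTheory.
Variables (R : realType) (A : dagger_category R).
Implicit Types x y z w : A.

Definition monic x y (f : hom x y) : Prop :=
  forall w (g h : hom w x), f \o g = f \o h -> g = h.

Definition epic x y (f : hom x y) : Prop :=
  forall w (g h : hom y w), g \o f = h \o f -> g = h.

Definition is_iso x y (f : hom x y) : Prop :=
  exists g : hom y x, g \o f = idm x /\ f \o g = idm y.

Definition isomorphic x y : Prop := exists f : hom x y, is_iso f.

Definition unitary x y (f : hom x y) : Prop :=
  f^† \o f = idm x /\ f \o f^† = idm y.

Definition zero_object z : Prop :=
  forall x, (forall f g : hom z x, f = g) /\ (forall f g : hom x z, f = g).

Definition is_kernel x y z (k : hom z x) (f : hom x y) : Prop :=
  f \o k = 0 /\
  forall w (g : hom w x), f \o g = 0 -> exists! h : hom w z, k \o h = g.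

Definition is_cokernel x y z (q : hom y z) (f : hom x y) : Prop :=
  q \o f = 0 /\
  forall w (g : hom y w), g \o f = 0 -> exists! h : hom z w, h \o q = g.

Definition is_direct_sum (I : finType) (F : I -> A) x : Prop :=
  exists (i : forall k, hom (F k) x) (p : forall k, hom x (F k)),
    [/\ forall k, p k \o i k = idm (F k),
        forall k l, k != l -> p l \o i k = 0
      & \sum_k (i k \o p k) = idm x].

Definition abelian : Prop :=
  (exists z, zero_object z) /\
  (forall x y, exists s, is_direct_sum (fun b : bool => if b then x else y) s) /\
  (forall x y (f : hom x y), exists z (k : hom z x), is_kernel k f) /\
  (forall x y (f : hom x y), exists z (q : hom y z), is_cokernel q f) /\
  (forall x y (f : hom x y), monic f -> exists z (g : hom y z), is_kernel f g) /\
  (forall x y (f : hom x y), epic f -> exists z (g : hom z x), is_cokernel f g).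

(** Nonzero, with no subobjects but [0] and itself. *)
Definition simple x : Prop :=
  ~ zero_object x /\
  forall y (f : hom y x), monic f -> f = 0 \/ is_iso f.

Definition semisimple : Prop :=
  abelian /\
  forall x, exists n (s : 'I_n -> A),
    (forall i, simple (s i)) /\ is_direct_sum s x.

Definition finitely_many_simples : Prop :=
  exists n (s : 'I_n -> A),
    (forall i, simple (s i)) /\
    (forall x, simple x -> exists i, isomorphic x (s i)).

(** Completeness of the norms is automatic, the hom spaces being finite
    dimensional. *)
Definition Cstar_norm (nrm : forall x y, hom x y -> R) : Prop :=
  (forall x y (f : hom x y), 0 <= nrm x y f) /\
  (forall x y (f : hom x y), nrm x y f = 0 -> f = 0) /\
  (forall x y (c : R[i]) (f : hom x y),
     (nrm x y (c *: f))%:C = `|c| * (nrm x y f)%:C) /\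
  (forall x y (f g : hom x y), nrm x y (f + g) <= nrm x y f + nrm x y g) /\
  (forall x y z (g : hom y z) (f : hom x y),
     nrm x z (g \o f) <= nrm y z g * nrm x y f) /\
  (forall x y (f : hom x y), nrm x x (f^† \o f) = nrm x y f ^+ 2).

Definition Cstar_category : Prop :=
  (exists nrm, Cstar_norm nrm) /\
  (forall x y (f : hom x y), exists h : hom x x, f^† \o f = h^† \o h).

Definition represents_simples (I : finType) (S : I -> A) : Prop :=
  [/\ forall i, simple (S i),
      forall i j, isomorphic (S i) (S j) -> i = j
    & forall x, simple x -> exists i, isomorphic x (S i)].

Record dual_bases (k x : A) := DualBases {
  db_size : nat;
  db_in : db_size.-tuple (hom k x);
  db_out : db_size.-tuple (hom x k);
  db_in_basis : basis_of fullv db_in;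
  db_out_basis : basis_of fullv db_out;
  db_dual : forall i j,
    tnth db_out i \o tnth db_in j = (i == j)%:R *: idm k
}.

End DaggerCategoryTheory.

Record unitary_category (R : realType) := UnitaryCategory {
  ucat :> dagger_category R;
  ucat_Cstar : Cstar_category ucat;
  ucat_semisimple : semisimple ucat
}.

Record unitary_monoidal_category (R : realType) := UnitaryMonoidalCategory {
  mcat :> unitary_category R;
  tens : mcat -> mcat -> mcat;
  tensm : forall x x' y y' : mcat,
    hom x x' -> hom y y' -> hom (tens x y) (tens x' y');
  unit : mcat;
  assoc : forall x y z : mcat, hom (tens (tens x y) z) (tens x (tens y z));
  lunit : forall x : mcat, hom (tens unit x) x;
  runit : forall x : mcat, hom (tens x unit) x;
  tens_id : forall x y : mcat, tensm (idm x) (idm y) = idm (tens x y);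
  tens_comp : forall (x x' x'' y y' y'' : mcat)
      (f' : hom x' x'') (f : hom x x') (g' : hom y' y'') (g : hom y y'),
    tensm (f' \o f) (g' \o g) = tensm f' g' \o tensm f g;
  tens_linl : forall (x x' y y' : mcat) (g : hom y y'),
    linear (fun f : hom x x' => tensm f g);
  tens_linr : forall (x x' y y' : mcat) (f : hom x x'),
    linear (fun g : hom y y' => tensm f g);
  tens_dag : forall (x x' y y' : mcat) (f : hom x x') (g : hom y y'),
    (tensm f g)^† = tensm f^† g^†;
  assoc_unitary : forall x y z, unitary (assoc x y z);
  lunit_unitary : forall x, unitary (lunit x);
  runit_unitary : forall x, unitary (runit x);
  assoc_nat : forall (x x' y y' z z' : mcat)
      (f : hom x x') (g : hom y y') (h : hom z z'),
    assoc x' y' z' \o tensm (tensm f g) h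
      = tensm f (tensm g h) \o assoc x y z;
  lunit_nat : forall (x x' : mcat) (f : hom x x'),
    lunit x' \o tensm (idm unit) f = f \o lunit x;
  runit_nat : forall (x x' : mcat) (f : hom x x'),
    runit x' \o tensm f (idm unit) = f \o runit x;
  pentagon : forall x y z w : mcat,
    assoc x y (tens z w) \o assoc (tens x y) z w
      = tensm (idm x) (assoc y z w) \o assoc x (tens y z) w
          \o tensm (assoc x y z) (idm w);
  triangle : forall x y : mcat,
    tensm (idm x) (lunit y) \o assoc x unit y = tensm (runit x) (idm y)
}.

Arguments tens {R u} x y.
Arguments tensm {R u x x' y y'} f g.
Arguments unit {R u}.
Arguments assoc {R u} x y z.
Arguments lunit {R u} x.
Arguments runit {R u} x.

Notation "x ⊗ y" := (tens x y) : cat_scope.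
Notation "f ⊗' g" := (tensm f g) : cat_scope.
Notation "𝟙" := unit : cat_scope.

Section Duals.
Variables (R : realType) (C : unitary_monoidal_category R).

(** [xd] is a left dual of [x]. *)
Definition is_duality (xd x : C) (ev : hom (xd ⊗ x) 𝟙) (coev : hom 𝟙 (x ⊗ xd)) :
    Prop :=
  runit x \o (idm x ⊗' ev) \o assoc x xd x \o (coev ⊗' idm x) = lunit x /\
  lunit xd \o (ev ⊗' idm xd) \o (assoc xd x xd)^† \o (idm xd ⊗' coev)
    = runit xd.

Definition rigid : Prop :=
  forall x : C,
    (exists xd (ev : hom (xd ⊗ x) 𝟙) (coev : hom 𝟙 (x ⊗ xd)),
       is_duality ev coev) /\
    (exists dx (ev : hom (x ⊗ dx) 𝟙) (coev : hom 𝟙 (dx ⊗ x)),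
       is_duality ev coev).

(** The quantum dimension [d] of a simple object [x]: the value of both loops
    for a solution of the duality equations normalised so that the two loop
    values agree.  (For non-simple [x] equality of the loop values does not
    single out the standard solutions, so this is only meant for simple [x].) *)
Definition quantum_dimension (x : C) (d : R) : Prop :=
  exists xd (ev : hom (xd ⊗ x) 𝟙) (coev : hom 𝟙 (x ⊗ xd)),
    [/\ is_duality ev coev,
        ev \o ev^† = d%:C *: idm 𝟙
      & coev^† \o coev = d%:C *: idm 𝟙].

End Duals.

Record unitary_fusion_category (R : realType) := UnitaryFusionCategory {
  fcat :> unitary_monoidal_category R;
  fcat_rigid : rigid fcat;
  fcat_unit_simple : simple (@unit R fcat);
  fcat_finite : finitely_many_simples fcat
}.

(** Representatives of the simple objects of a fusion category among which the
    unit object itself represents its class: they are indexed by [option I],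
    [None] standing for [𝟙]. *)
Definition with_unit (R : realType) (C : unitary_fusion_category R) (I : Type)
    (S : I -> C) (o : option I) : C :=
  if o is Some i then S i else 𝟙.

Record fusion_Irr (R : realType) (C : unitary_fusion_category R) := FusionIrr {
  fIrr_nonunit : finType;
  fIrr_rep : fIrr_nonunit -> C;
  fIrr_ax : represents_simples (with_unit fIrr_rep)
}.

Definition fIrr R (C : unitary_fusion_category R) (S : fusion_Irr C) : finType :=
  option (fIrr_nonunit S).

Definition fob R (C : unitary_fusion_category R) (S : fusion_Irr C) :
  fIrr S -> C := with_unit (@fIrr_rep R C S).

Record cat_Irr (R : realType) (A : unitary_category R) := CatIrr {
  cIrr : finType;
  cob : cIrr -> A;
  cob_ax : represents_simples cob
}.

(** The unit triangles for [massoc] follow from the axioms below, as do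
    those not listed for [assoc], [lassoc] and [rassoc]. *)
Record unitary_bimodule_category (R : realType)
    (C D : unitary_fusion_category R) := UnitaryBimoduleCategory {
  bcat :> unitary_category R;
  bcat_finite : finitely_many_simples bcat;
  lact : C -> bcat -> bcat;
  lactm : forall (a a' : C) (m m' : bcat),
    hom a a' -> hom m m' -> hom (lact a m) (lact a' m');
  ract : bcat -> D -> bcat;
  ractm : forall (m m' : bcat) (b b' : D),
    hom m m' -> hom b b' -> hom (ract m b) (ract m' b');
  lassoc : forall (a a' : C) (m : bcat),
    hom (lact (a ⊗ a') m) (lact a (lact a' m));
  rassoc : forall (m : bcat) (b b' : D),
    hom (ract (ract m b) b') (ract m (b ⊗ b'));
  massoc : forall (a : C) (m : bcat) (b : D),
    hom (ract (lact a m) b) (lact a (ract m b));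
  lactu : forall m : bcat, hom (lact 𝟙 m) m;
  ractu : forall m : bcat, hom (ract m 𝟙) m;
  lact_id : forall (a : C) (m : bcat), lactm (idm a) (idm m) = idm (lact a m);
  ract_id : forall (m : bcat) (b : D), ractm (idm m) (idm b) = idm (ract m b);
  lact_comp : forall (a a' a'' : C) (m m' m'' : bcat)
      (f' : hom a' a'') (f : hom a a') (g' : hom m' m'') (g : hom m m'),
    lactm (f' \o f) (g' \o g) = lactm f' g' \o lactm f g;
  ract_comp : forall (m m' m'' : bcat) (b b' b'' : D)
      (f' : hom m' m'') (f : hom m m') (g' : hom b' b'') (g : hom b b'),
    ractm (f' \o f) (g' \o g) = ractm f' g' \o ractm f g;
  lact_linl : forall (a a' : C) (m m' : bcat) (g : hom m m'),
    linear (fun f : hom a a' => lactm f g);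
  lact_linr : forall (a a' : C) (m m' : bcat) (f : hom a a'),
    linear (fun g : hom m m' => lactm f g);
  ract_linl : forall (m m' : bcat) (b b' : D) (g : hom b b'),
    linear (fun f : hom m m' => ractm f g);
  ract_linr : forall (m m' : bcat) (b b' : D) (f : hom m m'),
    linear (fun g : hom b b' => ractm f g);
  lact_dag : forall (a a' : C) (m m' : bcat) (f : hom a a') (g : hom m m'),
    (lactm f g)^† = lactm f^† g^†;
  ract_dag : forall (m m' : bcat) (b b' : D) (f : hom m m') (g : hom b b'),
    (ractm f g)^† = ractm f^† g^†;
  lassoc_unitary : forall a a' m, unitary (lassoc a a' m);
  rassoc_unitary : forall m b b', unitary (rassoc m b b');
  massoc_unitary : forall a m b, unitary (massoc a m b);
  lactu_unitary : forall m, unitary (lactu m);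
  ractu_unitary : forall m, unitary (ractu m);
  lassoc_nat : forall (a1 a2 a1' a2' : C) (m m' : bcat)
      (f : hom a1 a2) (f' : hom a1' a2') (g : hom m m'),
    lassoc a2 a2' m' \o lactm (f ⊗' f') g
      = lactm f (lactm f' g) \o lassoc a1 a1' m;
  rassoc_nat : forall (m m' : bcat) (b1 b2 b1' b2' : D)
      (g : hom m m') (f : hom b1 b2) (f' : hom b1' b2'),
    rassoc m' b2 b2' \o ractm (ractm g f) f'
      = ractm g (f ⊗' f') \o rassoc m b1 b1';
  massoc_nat : forall (a a' : C) (m m' : bcat) (b b' : D)
      (f : hom a a') (g : hom m m') (h : hom b b'),
    massoc a' m' b' \o ractm (lactm f g) h
      = lactm f (ractm g h) \o massoc a m b;
  lactu_nat : forall (m m' : bcat) (g : hom m m'),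
    lactu m' \o lactm (idm 𝟙) g = g \o lactu m;
  ractu_nat : forall (m m' : bcat) (g : hom m m'),
    ractu m' \o ractm g (idm 𝟙) = g \o ractu m;
  lpentagon : forall (a a' a'' : C) (m : bcat),
    lassoc a a' (lact a'' m) \o lassoc (a ⊗ a') a'' m
      = lactm (idm a) (lassoc a' a'' m) \o lassoc a (a' ⊗ a'') m
          \o lactm (assoc a a' a'') (idm m);
  rpentagon : forall (m : bcat) (b b' b'' : D),
    rassoc m b (b' ⊗ b'') \o rassoc (ract m b) b' b''
      = ractm (idm m) (assoc b b' b'') \o rassoc m (b ⊗ b') b''
          \o ractm (rassoc m b b') (idm b'');
  mpentagonl : forall (a a' : C) (m : bcat) (b : D),
    lassoc a a' (ract m b) \o massoc (a ⊗ a') m b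
      = lactm (idm a) (massoc a' m b) \o massoc a (lact a' m) b
          \o ractm (lassoc a a' m) (idm b);
  mpentagonr : forall (a : C) (m : bcat) (b b' : D),
    massoc a m (b ⊗ b') \o rassoc (lact a m) b b'
      = lactm (idm a) (rassoc m b b') \o massoc a (ract m b) b'
          \o ractm (massoc a m b) (idm b');
  ltriangle : forall (a : C) (m : bcat),
    lactm (idm a) (lactu m) \o lassoc a 𝟙 m = lactm (runit a) (idm m);
  rtriangle : forall (m : bcat) (b : D),
    ractm (idm m) (lunit b) \o rassoc m 𝟙 b = ractm (ractu m) (idm b)
}.

Arguments lact {R C D u} a m.
Arguments lactm {R C D u a a' m m'} f g.
Arguments ract {R C D u} m b.
Arguments ractm {R C D u m m' b b'} f g.
Arguments lassoc {R C D u} a a' m.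
Arguments rassoc {R C D u} m b b'.
Arguments massoc {R C D u} a m b.
Arguments lactu {R C D u} m.
Arguments ractu {R C D u} m.

Notation "a ▷ m" := (lact a m) : cat_scope.
Notation "f ▷' g" := (lactm f g) : cat_scope.
Notation "m ◁ b" := (ract m b) : cat_scope.
Notation "f ◁' g" := (ractm f g) : cat_scope.

Section Bimodules.
Variables (R : realType) (C D : unitary_fusion_category R).
Variable M : unitary_bimodule_category C D.

Definition stable_under_actions (P : M -> Prop) : Prop :=
  forall m, P m -> (forall a : C, P (a ▷ m)) /\ (forall b : D, P (m ◁ b)).

(** [M] is the direct sum of its full sub-bimodule categories [P] and [Q]. *)
Definition is_decomposition (P Q : M -> Prop) : Prop :=
  stable_under_actions P /\ stable_under_actions Q /\
  (forall p q, P p -> Q q ->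
     (forall f : hom p q, f = 0) /\ (forall f : hom q p, f = 0)) /\
  (forall m, exists p q, P p /\ Q q /\
     is_direct_sum (fun i : bool => if i then p else q) m).

Definition indecomposable : Prop :=
  (exists m : M, ~ zero_object m) /\
  forall P Q : M -> Prop, is_decomposition P Q ->
    (forall p, P p -> zero_object p) \/ (forall q, Q q -> zero_object q).

(** Neither the functor nor its structure isomorphisms are required to be
    compatible with the daggers. *)
Record bimodule_endofunctor := BimoduleEndofunctor {
  fo :> M -> M;
  fm : forall m n : M, hom m n -> hom (fo m) (fo n);
  fl : forall (a : C) (m : M), hom (a ▷ fo m) (fo (a ▷ m));
  fr : forall (m : M) (b : D), hom (fo m ◁ b) (fo (m ◁ b));
  fm_id : forall m, fm (idm m) = idm (fo m);
  fm_comp : forall m n p (g : hom n p) (f : hom m n),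
    fm (g \o f) = fm g \o fm f;
  fm_lin : forall m n, linear (@fm m n);
  fl_iso : forall a m, is_iso (fl a m);
  fr_iso : forall m b, is_iso (fr m b);
  fl_nat : forall (a a' : C) (m m' : M) (f : hom a a') (g : hom m m'),
    fl a' m' \o (f ▷' fm g) = fm (f ▷' g) \o fl a m;
  fr_nat : forall (m m' : M) (b b' : D) (g : hom m m') (f : hom b b'),
    fr m' b' \o (fm g ◁' f) = fm (g ◁' f) \o fr m b;
  fl_assoc : forall (a a' : C) (m : M),
    fm (lassoc a a' m) \o fl (a ⊗ a') m
      = fl a (a' ▷ m) \o (idm a ▷' fl a' m) \o lassoc a a' (fo m);
  fr_assoc : forall (m : M) (b b' : D),
    fm (rassoc m b b') \o fr (m ◁ b) b' \o (fr m b ◁' idm b')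
      = fr m (b ⊗ b') \o rassoc (fo m) b b';
  fm_assoc : forall (a : C) (m : M) (b : D),
    fm (massoc a m b) \o fr (a ▷ m) b \o (fl a m ◁' idm b)
      = fl a (m ◁ b) \o (idm a ▷' fr m b) \o massoc a (fo m) b;
  fl_unit : forall m, fm (lactu m) \o fl 𝟙 m = lactu (fo m);
  fr_unit : forall m, fm (ractu m) \o fr m 𝟙 = ractu (fo m)
}.

Record bimodule_transformation (f g : bimodule_endofunctor) :=
    BimoduleTransformation {
  bt :> forall m : M, hom (f m) (g m);
  bt_nat : forall (m n : M) (h : hom m n), bt n \o fm f h = fm g h \o bt m;
  bt_l : forall (a : C) (m : M),
    bt (a ▷ m) \o fl f a m = fl g a m \o (idm a ▷' bt m);
  bt_r : forall (m : M) (b : D),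
    bt (m ◁ b) \o fr f m b = fr g m b \o (bt m ◁' idm b)
}.

Definition bt_monic (f g : bimodule_endofunctor)
    (t : bimodule_transformation f g) : Prop :=
  forall (h : bimodule_endofunctor) (s s' : bimodule_transformation h f),
    (forall m, t m \o s m = t m \o s' m) -> forall m, s m = s' m.

Definition bt_iso (f g : bimodule_endofunctor)
    (t : bimodule_transformation f g) : Prop :=
  exists s : bimodule_transformation g f,
    forall m, s m \o t m = idm (f m) /\ t m \o s m = idm (g m).

Definition simple_endofunctor (f : bimodule_endofunctor) : Prop :=
  (exists m, ~ zero_object (f m)) /\
  forall (g : bimodule_endofunctor) (t : bimodule_transformation g f),
    bt_monic t -> (forall m, t m = 0) \/ bt_iso t.

(** The rebracketing [a ⊗ (a' ⊗ m ⊗ b') ⊗ b ≅ (a ⊗ a') ⊗ m ⊗ (b' ⊗ b)]; the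
    structure isomorphisms being unitary, daggers are inverses. *)
Definition rebracket (a a' : C) (m : M) (b' b : D) :
    hom ((a ▷ ((a' ▷ m) ◁ b')) ◁ b) (((a ⊗ a') ▷ m) ◁ (b' ⊗ b)) :=
  rassoc ((a ⊗ a') ▷ m) b' b
    \o ((((lassoc a a' m)^† ◁' idm b') \o (massoc a (a' ▷ m) b')^†) ◁' idm b).

Definition flr (f : bimodule_endofunctor) (a : C) (m : M) (b : D) :
    hom ((a ▷ f m) ◁ b) (f ((a ▷ m) ◁ b)) :=
  fr f (a ▷ m) b \o (fl f a m ◁' idm b).

Definition unitlr (m : M) : hom ((𝟙 ▷ m) ◁ 𝟙) m := lactu m \o ractu (𝟙 ▷ m).

Variables (IC : fusion_Irr C) (ID : fusion_Irr D) (IM : cat_Irr M).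

Local Notation "$ a" := (fob a) (at level 2, a at level 2).
Local Notation "# x" := (cob x) (at level 2, x at level 2).

Definition left_quantum_dimensions (dL : cIrr IM -> R) : Prop :=
  (forall m, 0 < dL m) /\
  forall (a : fIrr IC) (m : cIrr IM) (d : R), quantum_dimension $a d ->
    d * dL m = \sum_n (\dim {:hom ($a ▷ #m) #n})%:R * dL n.

Definition right_quantum_dimensions (dR : cIrr IM -> R) : Prop :=
  (forall m, 0 < dR m) /\
  forall (m : cIrr IM) (b : fIrr ID) (d : R), quantum_dimension $b d ->
    dR m * d = \sum_n (\dim {:hom (#m ◁ $b) #n})%:R * dR n.

(** The index [(a, b, (x, z), (u, w))] is that of the summand
    [Hom(x, a ⊗ z ⊗ b) ⊗ Hom(a ⊗ u ⊗ b, w)]. *)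
Definition tube_index : finType :=
  (fIrr IC * fIrr ID * (cIrr IM * cIrr IM) * (cIrr IM * cIrr IM))%type.

Definition tube_summand (p : tube_index) : vectType R[i] :=
  let: (a, b, (x, z), (u, w)) := p in
  tprod (hom #x (($a ▷ #z) ◁ $b)) (hom (($a ▷ #u) ◁ $b) #w).

Definition Tube : lmodType R[i] := dsum tube_summand.

Definition kronecker (x z : cIrr IM) : hom #x #z :=
  if x =P z is ReflectT e then ecast t (hom #x #t) e (idm #x) else 0.

Definition tube_one : Tube :=
  [ffun p : tube_index =>
     let: (a, b, (x, z), (u, w)) as p0 := p return tube_summand p0 in
     match a as a0, b as b0
       return tube_summand (a0, b0, (x, z), (u, w))
     with
     | None, None =>
         tpure ((unitlr #z)^† \o kronecker x z) (kronecker u w \o unitlr #u)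
     | _, _ => 0
     end].

Variable tau : forall k a a' : fIrr IC, dual_bases $k ($a ⊗ $a').
Variable sigma : forall s b' b : fIrr ID, dual_bases $s ($b' ⊗ $b).

(** The component in the summand [(k, s; x, z', u', w)] of [(f ⊗ g)(f' ⊗ g')],
    where [f ⊗ g] and [f' ⊗ g'] are in the summands [(a, b; x, z, u, w)] and
    [(a', b'; z, z', u', u)]. *)
Definition tube_mul_pure (k a a' : fIrr IC) (s b b' : fIrr ID)
    (x z u w z' u' : cIrr IM)
    (f : hom #x (($a ▷ #z) ◁ $b)) (g : hom (($a ▷ #u) ◁ $b) #w)
    (f' : hom #z (($a' ▷ #z') ◁ $b')) (g' : hom (($a' ▷ #u') ◁ $b') #u) :
    tprod (hom #x (($k ▷ #z') ◁ $s)) (hom (($k ▷ #u') ◁ $s) #w) :=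
  \sum_i \sum_j
    tpure
      (((tnth (db_out (tau k a a')) i ▷' idm #z')
            ◁' tnth (db_out (sigma s b' b)) j)
         \o rebracket $a $a' #z' $b' $b
         \o ((idm $a ▷' f') ◁' idm $b) \o f)
      (g \o ((idm $a ▷' g') ◁' idm $b)
         \o (rebracket $a $a' #u' $b' $b)^†
         \o ((tnth (db_in (tau k a a')) i ▷' idm #u')
               ◁' tnth (db_in (sigma s b' b)) j)).

Definition tube_mul (T T' : Tube) : Tube :=
  [ffun p : tube_index =>
     let: (k, s, (x, z'), (u', w)) as p0 := p return tube_summand p0 in
     \sum_a \sum_b \sum_a' \sum_b' \sum_z \sum_u
       tlift (fun f g =>
           tlift (fun f' g' => tube_mul_pure k s f g f' g')
             (T' (a', b', (z, z'), (u', u))))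
         (T (a, b, (x, z), (u, w)))].

Section TubeModule.
Variable F : bimodule_endofunctor.

Definition tube_module : lmodType R[i] :=
  dsum (fun p : cIrr IM * cIrr IM => hom (cob p.1) (F (cob p.2))).

Definition tube_act_pure (a : fIrr IC) (b : fIrr ID) (x z u w : cIrr IM)
    (f : hom #x (($a ▷ #z) ◁ $b)) (g : hom (($a ▷ #u) ◁ $b) #w)
    (alpha : hom #z (F #u)) : hom #x (F #w) :=
  fm F g \o flr F $a #u $b \o ((idm $a ▷' alpha) ◁' idm $b) \o f.

Definition tube_act (T : Tube) (v : tube_module) : tube_module :=
  [ffun p : cIrr IM * cIrr IM =>
     \sum_a \sum_b \sum_z \sum_u
       tlift (fun f g => tube_act_pure f g (v (z, u)))
         (T (a, b, (p.1, z), (u, p.2)))].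

End TubeModule.

End Bimodules.

(* Main.v *)
From HB Require Import structures.
Require Import Defs.
From mathcomp Require Import all_boot all_order all_algebra.
From mathcomp Require Import boolp reals complex.
Import Defs.

Set Implicit Arguments.
Unset Strict Implicit.
Unset Printing Implicit Defensive.

Import GRing.Theory.

Local Open Scope ring_scope.
Local Open Scope cat_scope.

(** The components in [Hom(x, f(y))] of an invariant subspace of [V^f] extend to
    a right ideal of morphisms [n -> f m] for every object [m].  By
    semisimplicity this ideal consists of the morphisms that factor through a
    split subobject of [f m], and invariance under the tube algebra together
    with rigidity (a snake argument, which inverts the structure maps) makes
    these subobjects a sub-bimodule functor of [f].  As [f] is simple, that
    subfunctor is zero or all of [f].  Multiplicativity of the action comes from
    completeness of dual bases, [\sum_k \sum_i tau_i \o tau_i^* = id]. *)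

(** Invariance closes the ideal under the structure maps of [f] but not under their inverses: it
    gives maps [a ▷ Y m -> Y (a ▷ m)] between the subobjects, while a bimodule functor needs
    isomorphisms. This is where duals enter. Acting by the dual of [a] and evaluating turns a
    morphism into [a ▷ f m] into a bent morphism into [f m], where membership in the ideal can be
    exploited, and bending loses no information. Functors need not respect daggers, so a section [t]
    and a retraction [r] describe each subobject; since [t] is monic, every coherence law of the
    subfunctor is the law of [f] composed with [t]. The subobject exists because hom spaces are
    finite dimensional: an idempotent of largest rank in the ideal fixes the whole ideal. An
    invariant subspace is determined by its components, because the projections of [V^f] onto
    components are themselves given by tube elements with [a = b = 𝟙]. *)

(** * Linear maps, direct sums and tensor products *)

Section LinearFunctions.
Variables (K : nzRingType) (U V : lmodType K) (f : U -> V).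
Hypothesis f_lin : linear f.

Lemma linear_fun0 : f 0 = 0.
Proof. by rewrite -(addNr 0) -scaleN1r f_lin scaleN1r addNr. Qed.

Lemma linear_funD u v : f (u + v) = f u + f v.
Proof. by rewrite -(scale1r u) f_lin !scale1r. Qed.

Lemma linear_funZ c u : f (c *: u) = c *: f u.
Proof. by rewrite -(addr0 (c *: u)) f_lin linear_fun0 addr0. Qed.

Lemma linear_funB u v : f (u - v) = f u - f v.
Proof. by rewrite linear_funD -scaleN1r linear_funZ scaleN1r. Qed.

Lemma linear_fun_sum (I : Type) (r : seq I) (P : pred I) (F : I -> U) :
  f (\sum_(i <- r | P i) F i) = \sum_(i <- r | P i) f (F i).
Proof. exact: (big_morph f linear_funD linear_fun0). Qed.

End LinearFunctions.

Section DirectSumTheory.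
Variables (K : fieldType) (I : finType) (F : I -> vectType K).

Definition dsingle (i : I) (x : F i) : dsum F :=
  [ffun j => if i =P j is ReflectT e then ecast k (F k) e x else 0].

Lemma dsingle_same i (x : F i) : dsingle x i = x.
Proof. by rewrite ffunE; case: eqP => // e; rewrite eq_axiomK. Qed.

Lemma dsingle_other i j (x : F i) : i != j -> dsingle x j = 0.
Proof. by rewrite ffunE; case: eqP. Qed.

Lemma dsumP (s t : dsum F) : (forall i, s i = t i) <-> s = t.
Proof. by split=> [e|-> //]; apply/ffunP. Qed.

Lemma dsum_linE (c : K) (s t : dsum F) i : (c *: s + t) i = c *: s i + t i.
Proof. by rewrite !ffunE. Qed.

Lemma dsum_sumE (J : Type) (r : seq J) (s : J -> dsum F) i :
  (\sum_(j <- r) s j) i = \sum_(j <- r) s j i.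
Proof.
elim: r => [|j r IH]; first by rewrite !big_nil ffunE.
by rewrite !big_cons ffunE IH.
Qed.

Lemma dsingle_linear i : linear (@dsingle i).
Proof.
move=> c x y; apply/dsumP => j; rewrite dsum_linE.
have [<-|ne] := eqVneq i j; first by rewrite !dsingle_same.
by rewrite !dsingle_other // scaler0 addr0.
Qed.

Lemma dsum_dsingle (s : dsum F) : s = \sum_i dsingle (s i).
Proof.
apply/dsumP => j; rewrite dsum_sumE (bigD1 j) //= dsingle_same big1 ?addr0 //.
by move=> i; exact: dsingle_other.
Qed.

End DirectSumTheory.

Section TensorTheory.
Variables (K : fieldType) (V W : vectType K).
Implicit Types U : lmodType K.

Lemma tlift_linear U (B : V -> W -> U) : linear (tlift B).
Proof.
move=> c s t; rewrite /tlift scaler_sumr -big_split; apply: eq_bigr => i _ /=.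
rewrite scaler_sumr -big_split; apply: eq_bigr => j _ /=.
by rewrite !mxE scalerDl scalerA.
Qed.

Lemma tlift_pure U (B : V -> W -> U) :
  (forall w, linear (B ^~ w)) -> (forall v, linear (B v)) ->
  forall v w, tlift B (tpure v w) = B v w.
Proof.
move=> Bl Br v w.
rewrite {2}(coord_vbasis (memvf v)) (linear_fun_sum (Bl w)).
apply: eq_bigr => i _; rewrite (linear_funZ (Bl w)).
rewrite {2}(coord_vbasis (memvf w)) (linear_fun_sum (Br _)) scaler_sumr.
by apply: eq_bigr => j _; rewrite (linear_funZ (Br _)) mxE scalerA.
Qed.

Lemma linear_tlift U U' (phi : U -> U') (B : V -> W -> U) t : linear phi ->
  phi (tlift B t) = tlift (fun v w => phi (B v w)) t.
Proof.
move=> lphi; rewrite (linear_fun_sum lphi); apply: eq_bigr => i _.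
by rewrite (linear_fun_sum lphi); apply: eq_bigr => j _; rewrite (linear_funZ lphi).
Qed.

Lemma eq_tlift U (B B' : V -> W -> U) t :
  (forall v w, B v w = B' v w) -> tlift B t = tlift B' t.
Proof.
by rewrite /tlift => e; apply: eq_bigr => i _; apply: eq_bigr => j _; rewrite e.
Qed.

Lemma tlift_lin U (c : K) (B B' : V -> W -> U) t :
  tlift (fun v w => c *: B v w + B' v w) t = c *: tlift B t + tlift B' t.
Proof.
rewrite /tlift scaler_sumr -big_split; apply: eq_bigr => i _ /=.
rewrite scaler_sumr -big_split; apply: eq_bigr => j _ /=.
by rewrite scalerDr !scalerA mulrC.
Qed.

Lemma tlift_sum U (I : Type) (r : seq I) (B : I -> V -> W -> U) t :
  tlift (fun v w => \sum_(i <- r) B i v w) t = \sum_(i <- r) tlift (B i) t.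
Proof.
rewrite /tlift [RHS]exchange_big; apply: eq_bigr => i _ /=.
rewrite [RHS]exchange_big; apply: eq_bigr => j _ /=.
by rewrite scaler_sumr.
Qed.

End TensorTheory.

(** * Semisimple dagger categories and split subobjects *)

Section DaggerCategories.
Variables (R : realType) (A : dagger_category R).
Implicit Types x y z w : A.

(** In a chain bracketed to the left, an inner composite [g \o f] is not a subterm. Quantifying over
    the prefix [k] makes an equation for it usable in rewriting. *)
Lemma comp_eq x y z w (g : hom y z) (f : hom x y) (h : hom x z) :
  g \o f = h -> forall k : hom z w, k \o g \o f = k \o h.
Proof. by move=> <- k; rewrite comp_assoc. Qed.

Lemma comp_eq3 x y z w v (g : hom z w) (f : hom y z) (e : hom x y)
    (h : hom x w) :
  g \o f \o e = h -> forall k : hom w v, k \o g \o f \o e = k \o h.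
Proof. by move=> <- k; rewrite !comp_assoc. Qed.

Lemma comp0l x y z (f : hom x y) : (0 : hom y z) \o f = 0.
Proof. exact: linear_fun0 (comp_linl f). Qed.
Lemma comp0r x y z (g : hom y z) : g \o (0 : hom x y) = 0.
Proof. exact: linear_fun0 (comp_linr g). Qed.
Lemma compBl x y z (g h : hom y z) (f : hom x y) :
  (g - h) \o f = (g \o f) - (h \o f).
Proof. exact: (linear_funB (comp_linl f)). Qed.
Lemma compBr x y z (g : hom y z) (f h : hom x y) :
  g \o (f - h) = (g \o f) - (g \o h).
Proof. exact: (linear_funB (comp_linr g)). Qed.
Lemma compDl x y z (g h : hom y z) (f : hom x y) :
  (g + h) \o f = (g \o f) + (h \o f).
Proof. exact: (linear_funD (comp_linl f)). Qed.
Lemma comp_suml x y z I (r : seq I) (P : pred I) (g : I -> hom y z)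
    (f : hom x y) :
  (\sum_(i <- r | P i) g i) \o f = \sum_(i <- r | P i) (g i \o f).
Proof. exact: (linear_fun_sum (comp_linl f)). Qed.
Lemma comp_sumr x y z I (r : seq I) (P : pred I) (f : I -> hom x y)
    (g : hom y z) :
  g \o (\sum_(i <- r | P i) f i) = \sum_(i <- r | P i) (g \o f i).
Proof. exact: (linear_fun_sum (comp_linr g)). Qed.
Lemma compZl x y z c (g : hom y z) (f : hom x y) : (c *: g) \o f = c *: (g \o f).
Proof. exact: (linear_funZ (comp_linl f)). Qed.

Lemma kernel_monic x y z (k : hom z x) (f : hom x y) :
  is_kernel k f -> monic k.
Proof.
move=> [fk0 univ] w g h e.
have fkg0 : f \o (k \o g) = 0 by rewrite comp_assoc fk0 comp0l.
by have [l [_ uniq_l]] := univ _ _ fkg0; rewrite -(uniq_l g) // (uniq_l h).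
Qed.

Lemma zero_object_idm x : idm x = 0 -> zero_object x.
Proof.
move=> id0 y; split=> f g.
  by rewrite -(comp_idr f) -(comp_idr g) id0 !comp0r.
by rewrite -(comp_idl f) -(comp_idl g) id0 !comp0l.
Qed.

Lemma schur x y (f : hom x y) :
  semisimple A -> simple x -> simple y -> f = 0 \/ is_iso f.
Proof.
move=> [[_ [_ [ker _]]] _] [_ sx] [_ sy].
have [z [k kk]] := ker _ _ f.
have [k0|[l [_ kl]]] := sx _ _ (kernel_monic kk).
  apply: sy => w g h e.
  have e0 : f \o (g - h) = 0 by rewrite compBr e subrr.
  have [l [lgh _]] := kk.2 _ _ e0.
  by apply/eqP; rewrite -subr_eq0 -lgh k0 comp0l.
by left; rewrite -(comp_idr f) -kl comp_assoc kk.1 comp0l.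
Qed.

Lemma simple_idm_neq0 x : simple x -> idm x <> 0.
Proof. by case=> nz _ /zero_object_idm. Qed.

(** Only the resolution of the identity is kept: it is inserted into composites to reduce statements
    about arbitrary objects to the chosen simples. *)
Lemma represents_decomp (I : finType) (S : I -> A) x :
  semisimple A -> represents_simples S ->
  exists n (s : 'I_n -> I) (i : forall k, hom (S (s k)) x)
    (p : forall k, hom x (S (s k))), \sum_k (i k \o p k) = idm x.
Proof.
move=> [_ ss] [_ _ repS].
have [n [s [simp_s [i [p [_ _ e]]]]]] := ss x.
have tE k : exists j, isomorphic (s k) (S j) by apply: repS.
have [t tP] := choice tE.
have uE k : exists u : hom (s k) (S (t k)) * hom (S (t k)) (s k),
    u.2 \o u.1 = idm (s k).
  by have [u [v [vu _]]] := tP k; exists (u, v).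
pose u k := sval (cid (uE k)).
have uP k : (u k).2 \o (u k).1 = idm (s k) by exact: (svalP (cid (uE k))).
exists n, t, (fun k => i k \o (u k).2), (fun k => (u k).1 \o p k).
rewrite -e; apply: eq_bigr => k _.
by rewrite comp_assoc (comp_eq (uP k)) comp_idr.
Qed.

Lemma represents_hom0 (I : finType) (S : I -> A) i j (f : hom (S i) (S j)) :
  semisimple A -> represents_simples S -> i != j -> f = 0.
Proof.
move=> ss [simpS isoS _] ne.
have [//|f_iso] := schur f ss (simpS i) (simpS j).
by move/eqP: ne; case; apply: isoS; exists f.
Qed.

Lemma hom_eq0 (I : finType) (S : I -> A) x y (f : hom x y) :
  semisimple A -> represents_simples S ->
  (forall i (h : hom (S i) x), f \o h = 0) -> f = 0.
Proof.
move=> ss repS f0.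
have [n [s [i [p e]]]] := represents_decomp x ss repS.
rewrite -(comp_idr f) -e comp_sumr big1 // => k _.
by rewrite comp_assoc f0 comp0l.
Qed.

(* Simples are injective: a nonzero [f] has a nonzero component in some simple
   summand of [x], which is invertible by Schur's lemma. *)
Lemma simple_retract s x (f : hom s x) :
  semisimple A -> simple s -> f <> 0 -> exists r : hom x s, r \o f = idm s.
Proof.
move=> ss simp_s f0.
have [n [t [simp_t [i [p [_ _ e]]]]]] := ss.2 x.
have [/forallP all0|] := boolP [forall k, p k \o f == 0].
  case: f0; rewrite -(comp_idl f) -e comp_suml big1 // => k _.
  by rewrite -comp_assoc (eqP (all0 k)) comp0r.
rewrite negb_forall => /existsP[k /eqP pf0].
have [//|[g [gpf _]]] := schur (p k \o f) ss simp_s (simp_t k).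
by exists (g \o p k); rewrite -comp_assoc.
Qed.

Section SplitSubobject.
Variables (x : A) (P : forall w, hom w x -> Prop).
Hypothesis P0 : forall w, P (0 : hom w x).
Hypothesis PD : forall w (g h : hom w x), P g -> P h -> P (g + h).
Hypothesis PN : forall w (g : hom w x), P g -> P (- g).
Hypothesis Pcomp : forall w v (g : hom w x) (h : hom v w), P g -> P (g \o h).

Hypothesis ss : semisimple A.

(** Take an idempotent of [P] of largest rank, measured by left multiplication on the endomorphisms
    of [x]. If it failed to fix some member of [P], a simple summand of the defect would split off
    and enlarge it. The induction is on a bound for the corank. *)
Lemma split_subobject_idempotent :
  exists e : hom x x, P e /\ forall w (g : hom w x), P g -> e \o g = g.
Proof.
pose L (e : hom x x) : {linear hom x x -> hom x x} :=
  HB.pack (fun g : hom x x => e \o g)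
    (GRing.isLinear.Build _ _ _ _ _ (comp_linr e)).
pose rk e := \dim (limg (linfun (L e))).
have rk_img e g : (e \o g \in limg (linfun (L e))).
  by rewrite -[e \o g]/(L e g) -(lfunE (L e)) memv_img ?memvf.
have step n : forall e, P e -> e \o e = e -> (\dim {:hom x x} - rk e < n)%N ->
    exists e : hom x x, P e /\ forall w (g : hom w x), P g -> e \o g = g.
  elim: n => // n IH e Pe ee lt_n.
  have [done|] := EM (forall w (g : hom w x), P g -> e \o g = g).
    by exists e.
  move=> /existsNP[w /existsNP[g /not_implyP[Pg neg]]].
  have [m [s [simp_s [i [p [_ _ ip]]]]]] := ss.2 w.
  have [/forallP all0|] := boolP [forall k, (g - (e \o g)) \o i k == 0].
    case: neg; apply/esym/eqP; rewrite -subr_eq0 -[_ - _]comp_idr -ip comp_sumr.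
    by apply/eqP/big1 => k _; rewrite comp_assoc (eqP (all0 k)) comp0l.
  rewrite negb_forall => /existsP[k /eqP b0].
  set b := (g - (e \o g)) \o i k in b0.
  have Pb : P b by apply/Pcomp/PD => //; apply/PN; exact: Pcomp.
  have eb : e \o b = 0 by rewrite comp_assoc compBr comp_assoc ee subrr comp0l.
  have [r rb] := simple_retract ss (simp_s k) b0.
  (* Since [e \o b = 0], this correction keeps [r'] a retraction of [b] and makes it vanish on [e];
     hence [b \o r'] is an idempotent orthogonal to [e], and [e + (b \o r')] is idempotent again. *)
  pose r' := r - (r \o e).
  have r'e : r' \o e = 0 by rewrite compBl -comp_assoc ee subrr.
  have r'b : r' \o b = idm (s k) by rewrite compBl -comp_assoc eb comp0r subr0.
  pose e' := e + (b \o r').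
  have e'e : e' \o e = e by rewrite compDl ee -comp_assoc r'e comp0r addr0.
  have e'b : e' \o b = b.
    by rewrite compDl eb -comp_assoc r'b comp_idr add0r.
  apply: (IH e'); first by apply: PD => //; exact: Pcomp.
    by rewrite {2}/e' (linear_funD (comp_linr e')) e'e comp_assoc e'b.
  have sub : (limg (linfun (L e)) <= limg (linfun (L e')))%VS.
    apply/subvP => _ /memv_imgP[h _ ->]; rewrite lfunE /= -e'e -comp_assoc.
    exact: rk_img.
  (* With equal ranks [b \o r'] would be fixed by [e], which kills [b]; then [b = b \o r' \o b]
     would vanish. *)
  have lt_rk : (rk e < rk e')%N.
    rewrite /rk ltn_neqAle (dimvS sub) andbT; apply/negP => /eqP eq_rk.
    have eqim : limg (linfun (L e)) = limg (linfun (L e')).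
      by apply/eqP; rewrite eqEdim sub eq_rk leqnn.
    have : b \o r' \in limg (linfun (L e)).
      by rewrite eqim -e'b -comp_assoc; exact: rk_img.
    case/memv_imgP => h _; rewrite lfunE /= => br.
    have br0 : b \o r' = 0 by rewrite br -ee -comp_assoc -br comp_assoc eb comp0l.
    have b00 : b = 0 by rewrite -(comp_idr b) -r'b comp_assoc br0 comp0l.
    by apply: (simple_idm_neq0 (simp_s k)); rewrite -r'b b00 comp0r.
  have rk_le : (rk e' <= \dim {:hom x x})%N by rewrite dimvS ?subvf.
  by apply: leq_trans (ltn_sub2l _ lt_rk) lt_n; apply: leq_trans lt_rk rk_le.
by apply: (step _ 0 _ _ (leqnn _)); rewrite ?comp0l.
Qed.

(** An idempotent [e] splits through the kernel [t] of [idm x - e]: as [e] is annihilated by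
    [idm x - e], it factors as [t \o r], and [t] being monic forces [r \o t] to be the identity. *)
Lemma split_subobject : exists y (t : hom y x) (r : hom x y),
  [/\ r \o t = idm y, P t & forall w (g : hom w x), P g -> t \o r \o g = g].
Proof.
have [e [Pe eP]] := split_subobject_idempotent.
have [[_ [_ [ker _]]] _] := ss.
have [y [t kt]] := ker _ _ (idm x - e).
have et : e \o t = t.
  by apply/esym/eqP; rewrite -subr_eq0 -{1}(comp_idl t) -compBl kt.1.
have e0 : (idm x - e) \o e = 0 by rewrite compBl comp_idl eP ?subrr.
have [r [tr _]] := kt.2 _ _ e0.
exists y, t, r; split.
- by apply: (kernel_monic kt); rewrite comp_assoc tr et comp_idr.
- by rewrite -et; exact: Pcomp.
- by move=> w g Pg; rewrite tr eP.
Qed.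

End SplitSubobject.

(** By Schur's lemma the blocks of different simples do not interact, and inside one block duality
    of the bases applies. So the sum [E] satisfies [p \o E = p] for every [p] from [x] to a simple,
    and such [p] detect the identity of [x]. *)
Lemma dual_bases_complete (I : finType) (S : I -> A) x
    (b : forall k, dual_bases (S k) x) :
  semisimple A -> represents_simples S ->
  \sum_k \sum_i (tnth (db_in (b k)) i \o tnth (db_out (b k)) i) = idm x.
Proof.
move=> ss repS; set E := \sum_k _.
have outE k j : tnth (db_out (b k)) j \o E = tnth (db_out (b k)) j.
  rewrite comp_sumr (bigD1 k) //= [X in _ + X]big1 ?addr0 => [|k' ne]; last first.
    rewrite comp_sumr big1 // => i _; rewrite comp_assoc.
    rewrite (represents_hom0 (_ \o _) ss repS) ?comp0l //.
  rewrite comp_sumr (bigD1 j) //= [X in _ + X]big1 ?addr0 => [|i ne].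
    by rewrite comp_assoc db_dual eqxx scale1r comp_idl.
  by rewrite comp_assoc db_dual eq_sym (negPf ne) scale0r comp0l.
have homE k (p : hom x (S k)) : p \o E = p.
  have pb : p \in <<db_out (b k)>>%VS.
    by rewrite (span_basis (db_out_basis (b k))) memvf.
  rewrite (coord_span pb) comp_suml; apply: eq_bigr => j _.
  by rewrite compZl -tnth_nth outE.
have [n [s [i [p e]]]] := represents_decomp x ss repS.
rewrite -(comp_idl E) -e comp_suml; apply: eq_bigr => k _.
by rewrite -comp_assoc homE.
Qed.

End DaggerCategories.

(** * Bimodule categories *)

Section Unitary.
Variables (R : realType) (A : dagger_category R).
Implicit Types x y z w : A.

Lemma unitary_comp x y z (g : hom y z) (f : hom x y) :
  unitary g -> unitary f -> unitary (g \o f).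
Proof.
move=> [gg gg'] [ff ff']; split; rewrite dag_comp comp_assoc.
  by rewrite (comp_eq gg) comp_idr.
by rewrite (comp_eq ff') comp_idr.
Qed.

Lemma dag_idm x : (idm x)^† = idm x.
Proof.
by rewrite -[LHS]comp_idr -{2}(dag_invol (idm x)) -dag_comp comp_idr dag_invol.
Qed.

Lemma unitary_dag x y (f : hom x y) : unitary f -> unitary f^†.
Proof. by case=> ff ff'; split; rewrite dag_invol. Qed.

(** Turns naturality or coherence of a unitary associator into the same law for its inverse, which
    is how associators enter [rebracket] and the snake arguments. *)
Lemma unitary_dag_square x y z w (u : hom y z) (f : hom x y) (g : hom w z)
    (v : hom x w) :
  unitary u -> unitary v -> u \o f = g \o v -> u^† \o g = f \o v^†.
Proof.
move=> [uu _] [_ vv] e.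
by rewrite -(comp_idr g) -vv !comp_assoc (comp_eq (esym e)) !comp_assoc uu comp_idl.
Qed.

Lemma unitary_epi x y z (u : hom x y) (f g : hom y z) :
  unitary u -> f \o u = g \o u -> f = g.
Proof.
by move=> [_ uu] e; rewrite -(comp_idr f) -uu comp_assoc e -comp_assoc uu comp_idr.
Qed.

Lemma unitary_mono x y z (u : hom y z) (f g : hom x y) :
  unitary u -> u \o f = u \o g -> f = g.
Proof.
by move=> [uu _] e; rewrite -(comp_idl f) -uu -comp_assoc e comp_assoc uu comp_idl.
Qed.

End Unitary.

Section BimoduleCategories.
Variables (R : realType) (C D : unitary_fusion_category R).
Variable M : unitary_bimodule_category C D.
Implicit Types (a : C) (b : D) (m n p : M).

Lemma lactm_idl a m n p (g : hom n p) (f : hom m n) :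
  (idm a ▷' (g \o f)) = (idm a ▷' g) \o (idm a ▷' f).
Proof. by rewrite -lact_comp comp_idl. Qed.

Lemma lactm_idr a a' a'' m (g : hom a' a'') (f : hom a a') :
  ((g \o f) ▷' idm m) = (g ▷' idm m) \o (f ▷' idm m).
Proof. by rewrite -lact_comp comp_idl. Qed.

Lemma ractm_idr b m n p (g : hom n p) (f : hom m n) :
  ((g \o f) ◁' idm b) = (g ◁' idm b) \o (f ◁' idm b).
Proof. by rewrite -ract_comp comp_idl. Qed.

Lemma ractm_idl b b' b'' m (g : hom b' b'') (f : hom b b') :
  (idm m ◁' (g \o f)) = (idm m ◁' g) \o (idm m ◁' f).
Proof. by rewrite -ract_comp comp_idl. Qed.

Lemma lactmC a a' m m' (h : hom a a') (g : hom m m') :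
  (idm a' ▷' g) \o (h ▷' idm m) = (h ▷' idm m') \o (idm a ▷' g).
Proof. by rewrite -!lact_comp !comp_idl !comp_idr. Qed.

Lemma ractmC m m' b b' (g : hom m m') (h : hom b b') :
  (g ◁' idm b') \o (idm m ◁' h) = (idm m' ◁' h) \o (g ◁' idm b).
Proof. by rewrite -!ract_comp !comp_idl !comp_idr. Qed.

Lemma unitary_lactm a m n (u : hom m n) : unitary u -> unitary (idm a ▷' u).
Proof.
by move=> [uu uu']; split; rewrite lact_dag dag_idm -lactm_idl ?uu ?uu' lact_id.
Qed.

Lemma unitary_lactm_idr a a' m (u : hom a a') : unitary u -> unitary (u ▷' idm m).
Proof.
by move=> [uu uu']; split; rewrite lact_dag dag_idm -lactm_idr ?uu ?uu' lact_id.
Qed.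

Lemma unitary_ractm b m n (u : hom m n) : unitary u -> unitary (u ◁' idm b).
Proof.
by move=> [uu uu']; split; rewrite ract_dag dag_idm -ractm_idr ?uu ?uu' ract_id.
Qed.

Lemma unitary_ractm_idl b b' m (u : hom b b') : unitary u -> unitary (idm m ◁' u).
Proof.
by move=> [uu uu']; split; rewrite ract_dag dag_idm -ractm_idl ?uu ?uu' ract_id.
Qed.

Lemma lactm_unit_eq0 m n (d : hom m n) : (idm 𝟙 ▷' d) = 0 -> d = 0.
Proof.
move=> d0; apply: (unitary_epi (lactu_unitary m)).
by rewrite -lactu_nat d0 comp0r comp0l.
Qed.

Lemma ractm_unit_eq0 m n (d : hom m n) : (d ◁' idm 𝟙) = 0 -> d = 0.
Proof.
move=> d0; apply: (unitary_epi (ractu_unitary m)).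
by rewrite -ractu_nat d0 comp0r comp0l.
Qed.

(* The snake identity recovers [d] from its bent version, up to the
   isomorphism [(lunit a ▷' idm p) \o (lassoc 𝟙 a p)^†]. *)
Lemma lact_bend_inj a ad (ev : hom (ad ⊗ a) 𝟙) (coev : hom 𝟙 (a ⊗ ad)) n p
    (d : hom n (a ▷ p)) :
  is_duality ev coev ->
  (ev ▷' idm p) \o (lassoc ad a p)^† \o (idm ad ▷' d) = 0 -> d = 0.
Proof.
move=> [snake _] bent0; apply: lactm_unit_eq0.
apply: (unitary_mono (unitary_dag (lassoc_unitary 𝟙 a p))).
apply: (unitary_mono (unitary_lactm_idr p (lunit_unitary a))).
rewrite !comp0r -snake !lactm_idr.
have nat_coev : ((coev ⊗' idm a) ▷' idm p) \o (lassoc 𝟙 a p)^†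
    = (lassoc (a ⊗ ad) a p)^† \o (coev ▷' idm (a ▷ p)).
  symmetry; apply: unitary_dag_square; try exact: lassoc_unitary.
  by rewrite lassoc_nat lact_id.
have pent : (assoc a ad a ▷' idm p) \o (lassoc (a ⊗ ad) a p)^†
    = (lassoc a (ad ⊗ a) p)^† \o (idm a ▷' (lassoc ad a p)^†)
        \o lassoc a ad (a ▷ p).
  symmetry; rewrite -{1}(dag_idm a) -lact_dag -dag_comp.
  apply: unitary_dag_square; last by rewrite lpentagon.
    exact: unitary_comp (unitary_lactm _ (lassoc_unitary _ _ _))
             (lassoc_unitary _ _ _).
  exact: lassoc_unitary.
have nat_ev : ((idm a ⊗' ev) ▷' idm p) \o (lassoc a (ad ⊗ a) p)^†
    = (lassoc a 𝟙 p)^† \o (idm a ▷' (ev ▷' idm p)).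
  by symmetry; apply: unitary_dag_square; rewrite ?lassoc_nat //;
    exact: lassoc_unitary.
have tri : (runit a ▷' idm p) \o (lassoc a 𝟙 p)^† = (idm a ▷' lactu p).
  by rewrite -ltriangle -comp_assoc (lassoc_unitary _ _ _).2 comp_idr.
rewrite !comp_assoc (comp_eq nat_coev) !comp_assoc.
rewrite (comp_eq pent) !comp_assoc (comp_eq nat_ev) !comp_assoc tri.
rewrite (comp_eq (esym (lactmC coev d))) !comp_assoc -tens_id.
rewrite (comp_eq (lassoc_nat _ _ _)) !comp_assoc.
have bent0' : (idm a ▷' (ev ▷' idm p)) \o (idm a ▷' (lassoc ad a p)^†)
    \o (idm a ▷' (idm ad ▷' d)) = 0.
  by rewrite -!lactm_idl bent0 (linear_fun0 (lact_linr _)).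
by rewrite (comp_eq3 bent0') comp0r !comp0l.
Qed.

(** The mirror image of the left case. Now [b] is the left dual of [bd], so it is the second snake
    identity, the one ending in [runit b], that straightens the strand. *)
Lemma ract_bend_inj b bd (ev : hom (b ⊗ bd) 𝟙) (coev : hom 𝟙 (bd ⊗ b)) n p
    (d : hom n (p ◁ b)) :
  is_duality ev coev ->
  (idm p ◁' ev) \o rassoc p b bd \o (d ◁' idm bd) = 0 -> d = 0.
Proof.
move=> [_ snake] bent0; apply: ractm_unit_eq0.
apply: (unitary_mono (rassoc_unitary p b 𝟙)).
apply: (unitary_mono (unitary_ractm_idl p (runit_unitary b))).
rewrite !comp0r -snake !ractm_idl.
have pent : (idm p ◁' (assoc b bd b)^†) \o rassoc p b (bd ⊗ b)
    = rassoc p (b ⊗ bd) b \o (rassoc p b bd ◁' idm b)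
        \o (rassoc (p ◁ b) bd b)^†.
  rewrite -{1}(dag_idm p) -ract_dag.
  apply: unitary_dag_square; last by rewrite comp_assoc rpentagon.
    exact: unitary_ractm_idl (assoc_unitary _ _ _).
  exact: rassoc_unitary.
have nat_d : (rassoc (p ◁ b) bd b)^† \o (d ◁' (idm bd ⊗' idm b))
    = ((d ◁' idm bd) ◁' idm b) \o (rassoc n bd b)^†.
  by apply: unitary_dag_square; rewrite ?rassoc_nat //; exact: rassoc_unitary.
rewrite !comp_assoc (comp_eq (esym (rassoc_nat _ _ _))) !comp_assoc.
rewrite (comp_eq pent) !comp_assoc (comp_eq (esym (rassoc_nat _ _ _))) !comp_assoc.
rewrite rtriangle ract_id (comp_eq (esym (ractmC d coev))) !comp_assoc -tens_id.
rewrite (comp_eq nat_d) !comp_assoc.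
have bent0' : ((idm p ◁' ev) ◁' idm b) \o (rassoc p b bd ◁' idm b)
    \o ((d ◁' idm bd) ◁' idm b) = 0.
  by rewrite -!ractm_idr bent0 (linear_fun0 (ract_linl _)).
by rewrite (comp_eq3 bent0') comp0r !comp0l.
Qed.

Definition lrm a a' m m' b b' (h : hom a a') (g : hom m m') (k : hom b b') :
  hom ((a ▷ m) ◁ b) ((a' ▷ m') ◁ b') := (h ▷' g) ◁' k.

Lemma lrmE a a' m m' b b' (h : hom a a') (g : hom m m') (k : hom b b') :
  lrm h g k = (h ▷' g) ◁' k.
Proof. by []. Qed.

Lemma lrm_comp a a' a'' m m' m'' b b' b'' (h' : hom a' a'') (h : hom a a')
    (g' : hom m' m'') (g : hom m m') (k' : hom b' b'') (k : hom b b') :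
  lrm (h' \o h) (g' \o g) (k' \o k) = lrm h' g' k' \o lrm h g k.
Proof. by rewrite /lrm lact_comp ract_comp. Qed.

Lemma lrm_lin2 a a' m m' b b' (h : hom a a') (k : hom b b') :
  linear (fun g : hom m m' => lrm h g k).
Proof. by move=> c g g'; rewrite /lrm lact_linr ract_linl. Qed.

Lemma lrm_lin1 a a' m m' b b' (g : hom m m') (k : hom b b') :
  linear (fun h : hom a a' => lrm h g k).
Proof. by move=> c h h'; rewrite /lrm lact_linl ract_linl. Qed.

Lemma lrm_lin3 a a' m m' b b' (h : hom a a') (g : hom m m') :
  linear (fun k : hom b b' => lrm h g k).
Proof. by move=> c k k'; rewrite /lrm ract_linr. Qed.

Lemma rebracket_unitary a a' m b' b : unitary (rebracket a a' m b' b).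
Proof.
apply: unitary_comp (rassoc_unitary _ _ _) _; apply: unitary_ractm.
apply: unitary_comp; last exact: unitary_dag (massoc_unitary _ _ _).
exact: unitary_ractm _ (unitary_dag (lassoc_unitary _ _ _)).
Qed.

Lemma rebracket_nat a a' m m' b' b (g : hom m m') :
  rebracket a a' m' b' b \o lrm (idm a) (lrm (idm a') g (idm b')) (idm b)
    = lrm (idm (a ⊗ a')) g (idm (b' ⊗ b)) \o rebracket a a' m b' b.
Proof.
rewrite /rebracket /lrm -(tens_id b' b) comp_assoc.
rewrite -rassoc_nat -!comp_assoc -!ractm_idr; congr (_ \o (_ ◁' _)).
rewrite -comp_assoc.
have -> : (massoc a (a' ▷ m') b')^† \o (idm a ▷' ((idm a' ▷' g) ◁' idm b'))
    = ((idm a ▷' (idm a' ▷' g)) ◁' idm b') \o (massoc a (a' ▷ m) b')^†.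
  by apply: unitary_dag_square; rewrite ?massoc_nat //; exact: massoc_unitary.
rewrite !comp_assoc -!ractm_idr; congr ((_ ◁' _) \o _).
rewrite -tens_id.
by apply: unitary_dag_square; rewrite ?lassoc_nat //; exact: lassoc_unitary.
Qed.

(** * Coherence of the two-sided structure maps of a bimodule endofunctor *)

Section Endofunctor.
Variable f : bimodule_endofunctor M.

Lemma fm_sum m n (I : Type) (r : seq I) (P : pred I) (g : I -> hom m n) :
  fm f (\sum_(i <- r | P i) g i) = \sum_(i <- r | P i) fm f (g i).
Proof. exact: (linear_fun_sum (@fm_lin R C D M f m n)). Qed.

Lemma fm_inverse m n (u : hom m n) (v : hom n m) : v \o u = idm m ->
  fm f v \o fm f u = idm (f m).
Proof. by move=> e; rewrite -fm_comp e fm_id. Qed.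

(** The associativity axiom solved for the inverse associator, the direction that occurs in
    [rebracket]. *)
Lemma fl_lassoc_dag a a' m :
  fl f (a ⊗ a') m \o (lassoc a a' (f m))^†
    = fm f (lassoc a a' m)^† \o fl f a (a' ▷ m) \o (idm a ▷' fl f a' m).
Proof.
rewrite -(comp_idr (_ \o (idm a ▷' _))) -(lassoc_unitary a a' (f m)).2 !comp_assoc.
rewrite (comp_eq3 (esym (fl_assoc f a a' m))) !comp_assoc.
by rewrite (fm_inverse (lassoc_unitary a a' m).1) comp_idl.
Qed.

Lemma fr_massoc_dag a m b :
  fr f (a ▷ m) b \o (fl f a m ◁' idm b) \o (massoc a (f m) b)^†
    = fm f (massoc a m b)^† \o fl f a (m ◁ b) \o (idm a ▷' fr f m b).
Proof.
rewrite -(comp_idr (_ \o (idm a ▷' _))) -(massoc_unitary a (f m) b).2 !comp_assoc.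
rewrite (comp_eq3 (esym (fm_assoc f a m b))) !comp_assoc.
by rewrite (fm_inverse (massoc_unitary a m b).1) comp_idl.
Qed.

Lemma flr_nat a a' m m' b b' (h : hom a a') (g : hom m m') (k : hom b b') :
  flr f a' m' b' \o lrm h (fm f g) k = fm f (lrm h g k) \o flr f a m b.
Proof.
rewrite /flr /lrm -comp_assoc -ract_comp fl_nat comp_idl.
rewrite -{1}(comp_idr k) ract_comp !comp_assoc fr_nat.
done.
Qed.

(** The coherence behind multiplicativity of the action. Each of the three associators in
    [rebracket] calls for one associativity axiom of [f]: [inner] treats the left and the middle
    one, and [fr_assoc] finishes. *)
Lemma flr_rebracket a a' m b' b :
  flr f (a ⊗ a') m (b' ⊗ b) \o rebracket a a' (f m) b' b
    = fm f (rebracket a a' m b' b) \o flr f a ((a' ▷ m) ◁ b') b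
        \o lrm (idm a) (flr f a' m b') (idm b).
Proof.
have inner : fm f (((lassoc a a' m)^† ◁' idm b') \o (massoc a (a' ▷ m) b')^†)
      \o fl f a ((a' ▷ m) ◁ b') \o (idm a ▷' flr f a' m b')
    = fr f ((a ⊗ a') ▷ m) b' \o (fl f (a ⊗ a') m ◁' idm b')
      \o (((lassoc a a' (f m))^† ◁' idm b') \o (massoc a (a' ▷ f m) b')^†).
  rewrite fm_comp lactm_idl !comp_assoc.
  rewrite (comp_eq3 (esym (fr_massoc_dag _ _ _))) !comp_assoc -fr_nat.
  have nat_m : (massoc a (f (a' ▷ m)) b')^† \o (idm a ▷' (fl f a' m ◁' idm b'))
      = ((idm a ▷' fl f a' m) ◁' idm b') \o (massoc a (a' ▷ f m) b')^†.
    by apply: unitary_dag_square; rewrite ?massoc_nat //; exact: massoc_unitary.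
  rewrite (comp_eq nat_m) !comp_assoc; congr (_ \o _).
  by rewrite -!comp_assoc -!ractm_idr comp_assoc -fl_lassoc_dag.
rewrite /rebracket fm_comp {1}/flr [flr f a ((_ ▷ _) ◁ _) b]/flr /lrm !comp_assoc.
rewrite (comp_eq (esym (fr_nat f _ _))) !comp_assoc.
have /= := congr1 (fun g => g ◁' idm b) inner; rewrite !ractm_idr => inner'.
rewrite (comp_eq3 inner').
rewrite ?ractm_idr ?comp_assoc fr_assoc !(comp_eq (rassoc_nat _ _ _)) tens_id.
by rewrite !comp_assoc !(comp_eq (rassoc_nat _ _ _)) tens_id !comp_assoc.
Qed.

Lemma flr_unit m : fm f (unitlr m) \o flr f 𝟙 m 𝟙 = unitlr (f m).
Proof.
rewrite /unitlr /flr fm_comp !comp_assoc (comp_eq (fr_unit f _)).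
by rewrite -comp_assoc ractu_nat comp_assoc fl_unit.
Qed.

Lemma unitlr_unitary m : unitary (unitlr m).
Proof. exact: unitary_comp (lactu_unitary _) (ractu_unitary _). Qed.

Lemma unitlr_nat m n (g : hom m n) :
  unitlr n \o lrm (idm 𝟙) g (idm 𝟙) = g \o unitlr m.
Proof.
by rewrite /unitlr /lrm -comp_assoc ractu_nat comp_assoc lactu_nat comp_assoc.
Qed.

End Endofunctor.

End BimoduleCategories.

(** * The tube algebra action *)

Section TubeRepresentation.
Variables (R : realType) (C D : unitary_fusion_category R).
Variable M : unitary_bimodule_category C D.
Variables (IC : fusion_Irr C) (ID : fusion_Irr D) (IM : cat_Irr M).
Variable f : bimodule_endofunctor M.

Local Notation "$ a" := (fob a) (at level 2, a at level 2).
Local Notation "# x" := (cob x) (at level 2, x at level 2).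

Local Notation act := (@tube_act R C D M IC ID IM f).

Section Pure.
Variables (a : fIrr IC) (b : fIrr ID) (x z u w : cIrr IM).
Implicit Types (h : hom #x (($a ▷ #z) ◁ $b)) (g : hom (($a ▷ #u) ◁ $b) #w).
Implicit Type alpha : hom #z (f #u).

Lemma tube_act_pure_lin1 g alpha : linear (fun h => tube_act_pure h g alpha).
Proof. by move=> c h h'; rewrite /tube_act_pure comp_linr. Qed.

Lemma tube_act_pure_lin2 h alpha : linear (fun g => tube_act_pure h g alpha).
Proof. by move=> c g g'; rewrite /tube_act_pure fm_lin !comp_linl. Qed.

Lemma tube_act_pure_lin3 h g : linear (tube_act_pure (F := f) h g).
Proof.
by move=> c v v'; rewrite /tube_act_pure lact_linr ract_linl comp_linr comp_linl.
Qed.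

Lemma tlift_act_pure h g alpha :
  tlift (fun h g => tube_act_pure h g alpha) (tpure h g) = tube_act_pure h g alpha.
Proof.
by rewrite tlift_pure // => ?; [exact: tube_act_pure_lin1 | exact: tube_act_pure_lin2].
Qed.

End Pure.

Lemma tube_act_linl v : linear (fun T : Tube IC ID IM => act T v).
Proof.
move=> c S T; apply/dsumP => p; rewrite dsum_linE !ffunE.
do 4!(rewrite scaler_sumr -big_split; apply: eq_bigr => ? _ /=).
by rewrite dsum_linE; exact: tlift_linear.
Qed.

Lemma tube_act_linr (T : Tube IC ID IM) : linear (act T).
Proof.
move=> c v v'; apply/dsumP => p; rewrite dsum_linE !ffunE.
do 4!(rewrite scaler_sumr -big_split; apply: eq_bigr => ? _ /=).
rewrite -tlift_lin; apply: eq_tlift => h g.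
by rewrite dsum_linE; exact: tube_act_pure_lin3.
Qed.

Lemma tube_act_pure_unit (x u : cIrr IM) (alpha : hom #x (f #u)) :
  tube_act_pure (IC := IC) (ID := ID) (a := None) (b := None)
    (unitlr #x)^† (unitlr #u) alpha = alpha.
Proof.
rewrite /tube_act_pure flr_unit unitlr_nat -comp_assoc.
by rewrite (unitlr_unitary _).2 comp_idr.
Qed.

Lemma kronecker_same (x : cIrr IM) : kronecker x x = idm #x.
Proof. by rewrite /kronecker; case: eqP => // e; rewrite eq_axiomK. Qed.

Lemma kronecker_other (x z : cIrr IM) : x != z -> kronecker x z = 0.
Proof. by rewrite /kronecker; case: eqP. Qed.

Lemma tube_act_one v : act (tube_one IC ID IM) v = v.
Proof.
apply/dsumP => -[x w]; rewrite ffunE /=.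
(* The unit has components only at [a = b = 𝟙], that is at [None]; there [kronecker] leaves just
   [z = x] and [u = w]. *)
rewrite (bigD1 None) //= [X in _ + X]big1 ?addr0; last first.
  case=> // a _; do 3!(rewrite big1 // => ? _).
  by rewrite ffunE; exact: (linear_fun0 (tlift_linear _)).
rewrite (bigD1 None) //= [X in _ + X]big1 ?addr0; last first.
  case=> // b _; do 2!(rewrite big1 // => ? _).
  by rewrite ffunE; exact: (linear_fun0 (tlift_linear _)).
rewrite (bigD1 x) //= [X in _ + X]big1 ?addr0; last first.
  move=> z ne; rewrite big1 // => u _; rewrite ffunE.
  apply: etrans (tlift_act_pure (a := None) (b := None) _ _ _) _.
  by rewrite kronecker_other 1?eq_sym // comp0r (linear_fun0 (tube_act_pure_lin1 _ _)).
rewrite (bigD1 w) //= [X in _ + X]big1 ?addr0; last first.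
  move=> u ne; rewrite ffunE.
  apply: etrans (tlift_act_pure (a := None) (b := None) _ _ _) _.
  by rewrite (kronecker_other ne) comp0l (linear_fun0 (tube_act_pure_lin2 _ _)).
rewrite ffunE; apply: etrans (tlift_act_pure (a := None) (b := None) _ _ _) _.
by rewrite !kronecker_same comp_idr comp_idl tube_act_pure_unit.
Qed.

Variable tau : forall k a a' : fIrr IC, dual_bases $k ($a ⊗ $a').
Variable sigma : forall s b' b : fIrr ID, dual_bases $s ($b' ⊗ $b).

(** Naturality of [flr] carries the basis vectors out of [fm f], so that they face their duals
    across [alpha]. Completeness of dual bases on [a ⊗ a'] and [b' ⊗ b] then removes the sums over
    [k] and [s]. *)
Lemma tube_act_mul_pure (a a' : fIrr IC) (b b' : fIrr ID)
    (x z u w z' u' : cIrr IM)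
    (h : hom #x (($a ▷ #z) ◁ $b)) (g : hom (($a ▷ #u) ◁ $b) #w)
    (h' : hom #z (($a' ▷ #z') ◁ $b')) (g' : hom (($a' ▷ #u') ◁ $b') #u)
    (alpha : hom #z' (f #u')) :
  \sum_k \sum_s tlift (fun h g => tube_act_pure h g alpha)
      (tube_mul_pure tau sigma k s h g h' g')
    = tube_act_pure h g (tube_act_pure h' g' alpha).
Proof.
(* [G] and [H] collect what stands after and before [alpha], with the strands [a ⊗ a'] and [b' ⊗ b]
   left whole. *)
pose G := fm f (g \o lrm (idm $a) g' (idm $b) \o (rebracket $a $a' #u' $b' $b)^†)
  \o flr f ($a ⊗ $a') #u' ($b' ⊗ $b).
pose H := rebracket $a $a' #z' $b' $b \o lrm (idm $a) h' (idm $b) \o h.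
have -> : \sum_k \sum_s tlift (fun h g => tube_act_pure h g alpha)
      (tube_mul_pure tau sigma k s h g h' g')
    = G \o lrm (idm _) alpha (idm _) \o H.
  rewrite -(dual_bases_complete (fun k => tau k a a') (ucat_semisimple _) (fIrr_ax IC)).
  rewrite (linear_fun_sum (lrm_lin1 _ _)) comp_sumr comp_suml.
  apply: eq_bigr => k _.
  rewrite (linear_fun_sum (lrm_lin1 _ _)) comp_sumr comp_suml.
  under [RHS]eq_bigr => i _.
    rewrite -(dual_bases_complete (fun s => sigma s b' b) (ucat_semisimple _) (fIrr_ax ID)).
    rewrite (linear_fun_sum (lrm_lin3 _ _)) comp_sumr comp_suml.
  over.
  rewrite [RHS]exchange_big; apply: eq_bigr => s _ /=.
  rewrite (linear_fun_sum (tlift_linear _)); apply: eq_bigr => i _.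
  rewrite (linear_fun_sum (tlift_linear _)).
  rewrite (linear_fun_sum (lrm_lin3 _ _)) comp_sumr comp_suml; apply: eq_bigr => j _.
  rewrite tlift_act_pure /tube_act_pure -!lrmE.
  set t := tnth (db_in _) i; set t' := tnth (db_out _) i.
  set r := tnth (db_in _) j; set r' := tnth (db_out _) j.
  have -> : lrm (t \o t') alpha (r \o r')
      = lrm t (fm f (idm _)) r \o lrm (idm _) alpha (idm _) \o lrm t' (idm _) r'.
    by rewrite -!lrm_comp fm_id !comp_idl !comp_idr.
  rewrite [fm f (_ \o lrm _ _ r)]fm_comp /G /H.
  (* Generalized because [comp_assoc] would unfold these composites. *)
  move: (rebracket _ _ #z' _ _) (rebracket _ _ #u' _ _) => rb rb'.
  move: (@flr R C D M f) (@flr_nat R C D M f) => L L_nat.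
  by rewrite !comp_assoc (comp_eq (L_nat _ _ _ _ _ _ _ _ _)) !comp_assoc.
(* Only rebracketing is left: it slides past [h'] and [alpha] by naturality, passes through [f] by
   [flr_rebracket], and cancels its dagger inside [fm f]. *)
rewrite /G /H /tube_act_pure -!lrmE.
have rbf := fm_inverse f (rebracket_unitary $a $a' #u' $b' $b).1.
move: (@rebracket R C D M) (@flr R C D M f) (@rebracket_nat R C D M)
  (@flr_rebracket R C D M f) (@flr_nat R C D M f) rbf => rb L rb_nat L_rb L_nat rbf.
rewrite !fm_comp !comp_assoc (comp_eq (esym (rb_nat _ _ _ _ _ _ _))) !comp_assoc.
rewrite (comp_eq (L_rb _ _ _ _ _)) !comp_assoc (comp_eq rbf) comp_idr.
rewrite (comp_eq (esym (L_nat _ _ _ _ _ _ _ _ _))) -!comp_assoc.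
do 2!congr (_ \o _); rewrite !comp_assoc; congr (_ \o _).
by rewrite -!lrm_comp !comp_idl.
Qed.

(** Grouping the ten indices into five consecutive pairs reduces the reordering to an exchange of
    five sums. *)
Lemma exchange_tube_sums (U : zmodType)
    (G : fIrr IC -> fIrr ID -> cIrr IM -> cIrr IM -> fIrr IC -> fIrr ID ->
      fIrr IC -> fIrr ID -> cIrr IM -> cIrr IM -> U) :
  \sum_k \sum_s \sum_z' \sum_u' \sum_a \sum_b \sum_a' \sum_b' \sum_z \sum_u
      G k s z' u' a b a' b' z u
    = \sum_a \sum_b \sum_z \sum_u \sum_a' \sum_b' \sum_z' \sum_u' \sum_k \sum_s
      G k s z' u' a b a' b' z u.
Proof.
have swap5 (I1 I2 I3 I4 I5 : finType) (F : I1 -> I2 -> I3 -> I4 -> I5 -> U) :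
    \sum_i \sum_j \sum_k \sum_l \sum_m F i j k l m
      = \sum_k \sum_m \sum_l \sum_j \sum_i F i j k l m.
  under eq_bigr => i _ do rewrite exchange_big.
  rewrite exchange_big; apply: eq_bigr => k _ /=.
  under eq_bigr => i _ do under eq_bigr => j _ do rewrite exchange_big.
  under eq_bigr => i _ do rewrite exchange_big.
  rewrite exchange_big; apply: eq_bigr => m _ /=.
  under eq_bigr => i _ do rewrite exchange_big.
  rewrite exchange_big; apply: eq_bigr => l _ /=.
  exact: exchange_big.
pose F (p1 : fIrr IC * fIrr ID) (p2 : cIrr IM * cIrr IM)
  (p3 p4 : fIrr IC * fIrr ID) (p5 : cIrr IM * cIrr IM) :=
  G p1.1 p1.2 p2.1 p2.2 p3.1 p3.2 p4.1 p4.2 p5.1 p5.2.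
transitivity (\sum_p1 \sum_p2 \sum_p3 \sum_p4 \sum_p5 F p1 p2 p3 p4 p5).
  by do 5!(rewrite [LHS]pair_bigA; apply: eq_bigr => -[? ?] _ /=).
rewrite swap5; symmetry.
by do 5!(rewrite [LHS]pair_bigA; apply: eq_bigr => -[? ?] _ /=).
Qed.

Lemma tube_act_mul S T v : act (tube_mul tau sigma S T) v = act S (act T v).
Proof.
apply/dsumP => -[x w]; rewrite !ffunE /=.
(* Both sides become tenfold sums of [G]: the left by linearity, the right because
   [tube_act_mul_pure], read backwards, supplies the sums over [k] and [s]. *)
pose G k s z' u' a b a' b' z u : hom #x (f #w) :=
  tlift (fun h g => tlift (fun h' g' =>
      tlift (fun h g => tube_act_pure h g (v (z', u')))
        (tube_mul_pure tau sigma k s h g h' g'))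
    (T (a', b', (z, z'), (u', u)))) (S (a, b, (x, z), (u, w))).
transitivity (\sum_k \sum_s \sum_z' \sum_u' \sum_a \sum_b \sum_a' \sum_b'
    \sum_z \sum_u G k s z' u' a b a' b' z u).
  do 4!(apply: eq_bigr => ? _); rewrite ffunE.
  do 6!(apply: etrans (linear_fun_sum (tlift_linear _) _ _ _) _; apply: eq_bigr => ? _).
  apply: etrans (linear_tlift _ _ (tlift_linear _)) _; apply: eq_tlift => h g.
  exact: (linear_tlift _ _ (tlift_linear _)).
rewrite exchange_tube_sums; apply: eq_bigr => a _; apply: eq_bigr => b _.
apply: eq_bigr => z _; apply: eq_bigr => u _.
have actE (h : hom #x (($a ▷ #z) ◁ $b)) (g : hom (($a ▷ #u) ◁ $b) #w) :
  tube_act_pure h g (act T v (z, u))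
    = \sum_a' \sum_b' \sum_z' \sum_u'
        tlift (fun (h' : hom #z (($a' ▷ #z') ◁ $b')) (g' : hom (($a' ▷ #u') ◁ $b') #u)
            => tube_act_pure h g (tube_act_pure h' g' (v (z', u'))))
          (T (a', b', (z, z'), (u', u))) :> hom #x (f #w).
  rewrite ffunE; have lin := tube_act_pure_lin3 h g.
  do 4!(rewrite (linear_fun_sum lin); apply: eq_bigr => ? _).
  exact: linear_tlift.
symmetry; apply: etrans (eq_tlift _ actE) _.
do 4!(rewrite tlift_sum; apply: eq_bigr => ? _).
under eq_tlift => h g.
  under eq_tlift => h' g' do rewrite -tube_act_mul_pure.
  rewrite tlift_sum; under eq_bigr => k _ do rewrite tlift_sum.
over.
by rewrite tlift_sum; apply: eq_bigr => k _; rewrite tlift_sum.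
Qed.

Lemma tube_act_representation :
  is_representation (tube_one IC ID IM) (tube_mul tau sigma) act.
Proof.
split; [exact: tube_act_linl | exact: tube_act_linr | exact: tube_act_one |].
exact: tube_act_mul.
Qed.

End TubeRepresentation.

(** * Invariant subspaces *)

Section TubeInvariant.
Variables (R : realType) (C D : unitary_fusion_category R).
Variable M : unitary_bimodule_category C D.
Variables (IC : fusion_Irr C) (ID : fusion_Irr D) (IM : cat_Irr M).
Variable f : bimodule_endofunctor M.

Local Notation "$ a" := (fob a) (at level 2, a at level 2).
Local Notation "# x" := (cob x) (at level 2, x at level 2).

Variable Q : forall x y : cIrr IM, hom #x (f #y) -> Prop.

Definition tube_invariant : Prop :=
  [/\ forall x y, Q (0 : hom #x (f #y)),
      forall x y c (v w : hom #x (f #y)), Q v -> Q w -> Q (c *: v + w)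
    & forall (a : fIrr IC) (b : fIrr ID) x z u w
        (h : hom #x (($a ▷ #z) ◁ $b)) (g : hom (($a ▷ #u) ◁ $b) #w)
        (v : hom #z (f #u)), Q v -> Q (tube_act_pure h g v)].

Hypothesis Q_inv : tube_invariant.

(* The extension to arbitrary objects of the subspaces [Q] of the components
   [Hom(x, f(y))] of [V^f]. *)
Definition in_ideal m n (v : hom n (f m)) : Prop :=
  forall x y (h : hom #x n) (g : hom m #y), Q (fm f g \o v \o h).

Lemma in_ideal0 m n : in_ideal (0 : hom n (f m)).
Proof. by move=> x y h g; rewrite comp0r comp0l; case: Q_inv. Qed.

Lemma in_ideal_lin m n c (v w : hom n (f m)) :
  in_ideal v -> in_ideal w -> in_ideal (c *: v + w).
Proof.
move=> Pv Pw x y h g; rewrite comp_linr comp_linl.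
by case: Q_inv => _ lin _; apply: lin.
Qed.

Lemma in_idealD m n (v w : hom n (f m)) :
  in_ideal v -> in_ideal w -> in_ideal (v + w).
Proof. by rewrite -{2}(scale1r v); exact: in_ideal_lin. Qed.

Lemma in_idealN m n (v : hom n (f m)) : in_ideal v -> in_ideal (- v).
Proof.
by move=> Pv; rewrite -scaleN1r -[X in in_ideal X]addr0;
  apply: in_ideal_lin => //; exact: in_ideal0.
Qed.

Lemma in_ideal_compr m n p (v : hom n (f m)) (h : hom p n) :
  in_ideal v -> in_ideal (v \o h).
Proof. by move=> Pv x y h' g; rewrite comp_assoc -comp_assoc. Qed.

Lemma in_ideal_compl m n p (v : hom n (f m)) (g : hom m p) :
  in_ideal v -> in_ideal (fm f g \o v).
Proof. by move=> Pv x y h g'; rewrite comp_assoc -fm_comp. Qed.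

(** Tube elements with [a = b = 𝟙] act by composition on both sides, so [Q] is already closed under
    morphisms between simples and the extension adds nothing there. *)
Lemma in_idealE x y (v : hom #x (f #y)) : in_ideal v <-> Q v.
Proof.
split=> [/(_ x y (idm _) (idm _))|Qv x' y' h g].
  by rewrite fm_id comp_idl comp_idr.
have [_ _ /(_ None None _ _ _ _ ((unitlr #x)^† \o h) (g \o unitlr #y) v Qv)] := Q_inv.
rewrite /tube_act_pure fm_comp -!lrmE.
rewrite (comp_eq (flr_unit f _)) (comp_eq (unitlr_nat _)) -[X in Q X -> _]comp_assoc.
rewrite -[(v \o _) \o _]comp_assoc [unitlr _ \o _]comp_assoc (unitlr_unitary _).2.
by rewrite comp_idl !comp_assoc.
Qed.

(** Invariance speaks only of simple objects. Resolving the identities of [a], [b], [n] and [m] into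
    simples writes the composite as a sum of pure tube elements acting on components of [v] that lie
    in [Q]. *)
Lemma in_ideal_lrm a b n m (v : hom n (f m)) :
  in_ideal v -> in_ideal (flr f a m b \o lrm (idm a) v (idm b)).
Proof.
move=> Pv x y h g.
have [na [sa [ia [pa ea]]]] := represents_decomp a (ucat_semisimple _) (fIrr_ax IC).
have [nb [sb [ib [pb eb]]]] := represents_decomp b (ucat_semisimple _) (fIrr_ax ID).
have [nn [sn [jn [pn en]]]] := represents_decomp n (ucat_semisimple _) (cob_ax IM).
have [nm [sm [jm [pm em]]]] := represents_decomp m (ucat_semisimple _) (cob_ax IM).
have [Q0 Qlin Qact] := Q_inv.
have Qsum k (F : 'I_k -> hom #x (f #y)) : (forall i, Q (F i)) -> Q (\sum_i F i).
  move=> QF; apply: (big_ind (@Q x y)) => // u w Qu Qw.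
  by rewrite -(scale1r u); exact: Qlin.
have vE : v = \sum_i \sum_j (fm f (jm i) \o (fm f (pm i) \o v \o jn j) \o pn j).
  under eq_bigr => i _.
    under eq_bigr => j _ do rewrite !comp_assoc -fm_comp -comp_assoc.
    rewrite -comp_sumr en comp_idr.
  over.
  by rewrite -comp_suml -fm_sum em fm_id comp_idl.
rewrite -ea (linear_fun_sum (lrm_lin1 _ _)) !(comp_sumr, comp_suml); apply: (Qsum) => i.
rewrite -eb (linear_fun_sum (lrm_lin3 _ _)) !(comp_sumr, comp_suml); apply: (Qsum) => j.
rewrite vE (linear_fun_sum (lrm_lin2 _ _)) !(comp_sumr, comp_suml); apply: (Qsum) => k.
rewrite (linear_fun_sum (lrm_lin2 _ _)) !(comp_sumr, comp_suml); apply: (Qsum) => l.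
have Qv := (in_idealE _).1 (in_ideal_compr (jn l) (in_ideal_compl (pm k) Pv)).
move: (Qact _ _ _ _ _ _ (lrm (pa i) (pn l) (pb j) \o h)
  (g \o lrm (ia i) (jm k) (ib j)) _ Qv).
rewrite /tube_act_pure -!lrmE fm_comp; set u := _ \o jn l.
have -> : lrm (ia i \o pa i) (fm f (jm k) \o u \o pn l) (ib j \o pb j)
    = lrm (ia i) (fm f (jm k)) (ib j) \o lrm (idm _) u (idm _)
      \o lrm (pa i) (pn l) (pb j).
  by rewrite -!lrm_comp !comp_idr.
move: u => u; move: (@flr R C D M f) (@flr_nat R C D M f) => L L_nat.
by rewrite !comp_assoc (comp_eq (L_nat _ _ _ _ _ _ _ _ _)) !comp_assoc.
Qed.

(** The two-sided closure at [b = 𝟙], conjugated by right unitors to remove the unit strand. *)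
Lemma in_ideal_lactm a n m (v : hom n (f m)) :
  in_ideal v -> in_ideal (fl f a m \o (idm a ▷' v)).
Proof.
move=> /(in_ideal_lrm (a := a) (b := 𝟙)) /(in_ideal_compl (ractu (a ▷ m))).
move=> /(in_ideal_compr ((ractu (a ▷ n))^†)).
rewrite /flr lrmE !comp_assoc fr_unit ractu_nat (comp_eq (ractu_nat _)) comp_assoc.
by rewrite (comp_eq (ractu_unitary _).2) comp_idr.
Qed.

Lemma in_ideal_ractm b n m (v : hom n (f m)) :
  in_ideal v -> in_ideal (fr f m b \o (v ◁' idm b)).
Proof.
move=> /(in_ideal_lrm (a := 𝟙) (b := b)) /(in_ideal_compl (lactu m ◁' idm b)).
move=> /(in_ideal_compr ((lactu n)^† ◁' idm b)).
rewrite /flr lrmE !comp_assoc -fr_nat -!comp_assoc -!ractm_idr.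
by rewrite !comp_assoc fl_unit lactu_nat -comp_assoc (lactu_unitary _).2 comp_idr.
Qed.

Section Absorbed.
Variables (m : M) (e : hom (f m) (f m)).
Hypothesis eP : forall n (v : hom n (f m)), in_ideal v -> e \o v = v.

(** This says that undoing [fl] does not leave the subobject. The bent form of [v] takes values in
    [f m] and lies in the ideal there, so [e] fixes it; [e] commutes with bending, and bending is
    injective. *)
Lemma in_ideal_lactm_absorb a n (v : hom n (a ▷ f m)) :
  in_ideal (fl f a m \o v) -> (idm a ▷' e) \o v = v.
Proof.
move=> Pv; have [[ad [ev [coev dual]]] _] := fcat_rigid a.
apply/eqP; rewrite -subr_eq0; apply/eqP; apply: (lact_bend_inj dual).
rewrite (linear_funB (lact_linr _)) compBr; apply/eqP; rewrite subr_eq0; apply/eqP.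
set B := RHS.
(* Act by [ad] on [fl f a m \o v] and evaluate: coherence of [f] lets the associator and [ev] pass
   through the functor, which leaves the bent form of [v] itself. *)
have PB : in_ideal (lactu (f m) \o B).
  have := in_ideal_compl (lactu m \o (ev ▷' idm m) \o (lassoc ad a m)^†)
    (in_ideal_lactm (a := ad) Pv).
  rewrite lactm_idl !fm_comp !comp_assoc (comp_eq3 (esym (fl_lassoc_dag _ _ _ _))).
  by rewrite ?comp_assoc (comp_eq (esym (fl_nat _ _ _))) ?comp_assoc
    fl_unit fm_id /B ?comp_assoc.
transitivity ((idm 𝟙 ▷' e) \o B).
  rewrite lactm_idl /B !comp_assoc lactmC; congr (_ \o _).
  rewrite -!comp_assoc; congr (_ \o _).
  rewrite -tens_id.
  by apply: unitary_dag_square; rewrite ?lassoc_nat //; exact: lassoc_unitary.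
by apply: (unitary_mono (lactu_unitary _)); rewrite comp_assoc lactu_nat -comp_assoc eP.
Qed.

Lemma in_ideal_ractm_absorb b n (v : hom n (f m ◁ b)) :
  in_ideal (fr f m b \o v) -> (e ◁' idm b) \o v = v.
Proof.
move=> Pv; have [_ [bd [ev [coev dual]]]] := fcat_rigid b.
apply/eqP; rewrite -subr_eq0; apply/eqP; apply: (ract_bend_inj dual).
rewrite (linear_funB (ract_linl _)) compBr; apply/eqP; rewrite subr_eq0; apply/eqP.
set B := RHS.
have PB : in_ideal (ractu (f m) \o B).
  have := in_ideal_compl (ractu m \o (idm m ◁' ev) \o rassoc m b bd)
    (in_ideal_ractm (b := bd) Pv).
  rewrite ractm_idr !fm_comp !comp_assoc (comp_eq3 (fr_assoc _ _ _ _)).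
  by rewrite ?comp_assoc (comp_eq (esym (fr_nat _ _ _))) ?comp_assoc
    fr_unit fm_id /B ?comp_assoc.
transitivity ((e ◁' idm 𝟙) \o B).
  rewrite ractm_idr /B !comp_assoc ractmC; congr (_ \o _).
  by rewrite -!comp_assoc rassoc_nat tens_id.
by apply: (unitary_mono (ractu_unitary _)); rewrite comp_assoc ractu_nat -comp_assoc eP.
Qed.

End Absorbed.

End TubeInvariant.

(** * Sub-bimodule functors carried by split subobjects *)

Section SubEndofunctor.
Variables (R : realType) (C D : unitary_fusion_category R).
Variable M : unitary_bimodule_category C D.
Variable f : bimodule_endofunctor M.
Variables (Y : M -> M) (t : forall m, hom (Y m) (f m)).
Variable r : forall m, hom (f m) (Y m).
Hypothesis rt : forall m, r m \o t m = idm (Y m).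
Variable gm : forall m n, hom m n -> hom (Y m) (Y n).
Variable gl : forall a m, hom (a ▷ Y m) (Y (a ▷ m)).
Variable gr : forall m b, hom (Y m ◁ b) (Y (m ◁ b)).
Hypothesis tgm : forall m n (h : hom m n), t n \o gm h = fm f h \o t m.
Hypothesis tgl : forall a m, t (a ▷ m) \o gl a m = fl f a m \o (idm a ▷' t m).
Hypothesis tgr : forall m b, t (m ◁ b) \o gr m b = fr f m b \o (t m ◁' idm b).
Hypothesis tr_lactm : forall a m (v : hom (Y (a ▷ m)) (a ▷ f m)),
  fl f a m \o v = t (a ▷ m) -> (idm a ▷' (t m \o r m)) \o v = v.
Hypothesis tr_ractm : forall m b (v : hom (Y (m ◁ b)) (f m ◁ b)),
  fr f m b \o v = t (m ◁ b) -> ((t m \o r m) ◁' idm b) \o v = v.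

(** Cancelling [t] reduces each functor axiom below to the corresponding axiom of [f]. *)
Lemma sub_mono m n (u v : hom n (Y m)) : t m \o u = t m \o v -> u = v.
Proof. by move=> e; rewrite -(comp_idl u) -rt -comp_assoc e comp_assoc rt comp_idl. Qed.

Fact sub_gm_id m : gm (idm m) = idm (Y m).
Proof. by apply: sub_mono; rewrite tgm fm_id comp_idl comp_idr. Qed.

Fact sub_gm_comp m n p (g : hom n p) (h : hom m n) : gm (g \o h) = gm g \o gm h.
Proof.
apply: sub_mono; rewrite tgm fm_comp comp_assoc tgm.
by rewrite (comp_eq (tgm h)) !comp_assoc.
Qed.

Fact sub_gm_lin m n : linear (@gm m n).
Proof.
move=> c g h; apply: sub_mono.
by rewrite tgm fm_lin comp_linl comp_linr !tgm.
Qed.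

(** The inverse is that of [fl] compressed by [t] and [r]. It is a left inverse because [r \o t] is
    the identity; for the other side [tr_lactm] is essential, since it absorbs the idempotent
    [t \o r] that appears in the middle. *)
Fact sub_gl_iso a m : is_iso (gl a m).
Proof.
have [v [vl lv]] := fl_iso f a m.
exists ((idm a ▷' r m) \o v \o t (a ▷ m)); split.
  by rewrite (comp_eq (tgl a m)) comp_assoc (comp_eq vl) comp_idr -lactm_idl rt lact_id.
apply: sub_mono; rewrite !comp_assoc tgl (comp_eq (esym (lactm_idl _ _ _))).
rewrite -!comp_assoc [_ \o (v \o _)]tr_lactm ?comp_assoc lv ?comp_idl ?comp_idr //.
Qed.

Fact sub_gr_iso m b : is_iso (gr m b).
Proof.
have [v [vl lv]] := fr_iso f m b.
exists ((r m ◁' idm b) \o v \o t (m ◁ b)); split.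
  by rewrite (comp_eq (tgr m b)) comp_assoc (comp_eq vl) comp_idr -ractm_idr rt ract_id.
apply: sub_mono; rewrite !comp_assoc tgr (comp_eq (esym (ractm_idr _ _ _))).
rewrite -!comp_assoc [_ \o (v \o _)]tr_ractm ?comp_assoc lv ?comp_idl ?comp_idr //.
Qed.

Fact sub_gl_nat a a' m m' (h : hom a a') (g : hom m m') :
  gl a' m' \o (h ▷' gm g) = gm (h ▷' g) \o gl a m.
Proof.
apply: sub_mono; rewrite !comp_assoc tgl tgm (comp_eq (tgl a m)) comp_assoc -fl_nat.
by rewrite -!comp_assoc -!lact_comp comp_idl comp_idr tgm.
Qed.

Fact sub_gr_nat m m' b b' (g : hom m m') (h : hom b b') :
  gr m' b' \o (gm g ◁' h) = gm (g ◁' h) \o gr m b.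
Proof.
apply: sub_mono; rewrite !comp_assoc tgr tgm (comp_eq (tgr m b)) comp_assoc -fr_nat.
by rewrite -!comp_assoc -!ract_comp comp_idl comp_idr tgm.
Qed.

Fact sub_gl_assoc a a' m :
  gm (lassoc a a' m) \o gl (a ⊗ a') m
    = gl a (a' ▷ m) \o (idm a ▷' gl a' m) \o lassoc a a' (Y m).
Proof.
apply: sub_mono; rewrite !comp_assoc tgm tgl (comp_eq (tgl _ _)) comp_assoc fl_assoc.
rewrite (comp_eq (esym (lactm_idl _ _ _))) tgl lactm_idl -!comp_assoc.
by rewrite -lassoc_nat tens_id.
Qed.

Fact sub_gr_assoc m b b' :
  gm (rassoc m b b') \o gr (m ◁ b) b' \o (gr m b ◁' idm b')
    = gr m (b ⊗ b') \o rassoc (Y m) b b'.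
Proof.
apply: sub_mono; rewrite !comp_assoc tgm tgr (comp_eq (tgr _ _)) comp_assoc.
rewrite (comp_eq (esym (ractm_idr _ _ _))) tgr ractm_idr comp_assoc fr_assoc.
by rewrite -!comp_assoc rassoc_nat tens_id.
Qed.

Fact sub_gm_assoc a m b :
  gm (massoc a m b) \o gr (a ▷ m) b \o (gl a m ◁' idm b)
    = gl a (m ◁ b) \o (idm a ▷' gr m b) \o massoc a (Y m) b.
Proof.
apply: sub_mono; rewrite !comp_assoc tgm tgl (comp_eq (tgr _ _)) comp_assoc.
rewrite (comp_eq (esym (ractm_idr _ _ _))) tgl ractm_idr comp_assoc fm_assoc.
rewrite (comp_eq (esym (lactm_idl _ _ _))) tgr lactm_idl -!comp_assoc.
by rewrite massoc_nat.
Qed.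

Fact sub_gl_unit m : gm (lactu m) \o gl 𝟙 m = lactu (Y m).
Proof.
by apply: sub_mono; rewrite comp_assoc tgm (comp_eq (tgl _ _)) comp_assoc fl_unit lactu_nat.
Qed.

Fact sub_gr_unit m : gm (ractu m) \o gr m 𝟙 = ractu (Y m).
Proof.
by apply: sub_mono; rewrite comp_assoc tgm (comp_eq (tgr _ _)) comp_assoc fr_unit ractu_nat.
Qed.

Definition sub_endofunctor : bimodule_endofunctor M :=
  BimoduleEndofunctor sub_gm_id sub_gm_comp sub_gm_lin sub_gl_iso sub_gr_iso
    sub_gl_nat sub_gr_nat sub_gl_assoc sub_gr_assoc sub_gm_assoc sub_gl_unit sub_gr_unit.

Definition sub_inclusion : bimodule_transformation sub_endofunctor f :=
  @BimoduleTransformation _ _ _ _ sub_endofunctor f t tgm tgl tgr.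

Lemma simple_sub_endofunctor : simple_endofunctor f ->
  (forall m, t m = 0) \/ (forall m, t m \o r m = idm (f m)).
Proof.
case=> _ /(_ _ sub_inclusion) [|t0|[s sP]].
- by move=> h u v e m; apply: sub_mono; exact: e.
- by left.
(* A retraction of an isomorphism is its inverse. *)
right=> m; have [_ ts] := sP m.
by rewrite -(comp_idr (_ \o _)) -[X in _ \o X]ts comp_assoc (comp_eq (rt m)) comp_idr ts.
Qed.

End SubEndofunctor.

(** * Irreducibility of the tube module *)

Section TubeIrreducible.
Variables (R : realType) (C D : unitary_fusion_category R).
Variable M : unitary_bimodule_category C D.
Variables (IC : fusion_Irr C) (ID : fusion_Irr D) (IM : cat_Irr M).
Variable f : bimodule_endofunctor M.
Hypothesis f_simple : simple_endofunctor f.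

Local Notation "$ a" := (fob a) (at level 2, a at level 2).
Local Notation "# x" := (cob x) (at level 2, x at level 2).

Lemma tube_invariant_trivial (Q : forall x y : cIrr IM, hom #x (f #y) -> Prop) :
  tube_invariant IC ID Q ->
  (forall x y (v : hom #x (f #y)), Q x y v -> v = 0) \/
  (forall x y (v : hom #x (f #y)), Q x y v).
Proof.
move=> Q_inv.
have subE m : exists s : {Y : M & (hom Y (f m) * hom (f m) Y)%type},
    [/\ (projT2 s).2 \o (projT2 s).1 = idm (projT1 s), in_ideal Q (projT2 s).1
      & forall n (v : hom n (f m)), in_ideal Q v ->
          (projT2 s).1 \o (projT2 s).2 \o v = v].
  have [||||Y [t [r [rt Pt Pr]]]] :=
      @split_subobject _ M (f m) (fun n => @in_ideal _ _ _ _ _ _ Q m n)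
        _ _ _ _ (ucat_semisimple M).
  - by move=> n; exact: (in_ideal0 Q_inv).
  - by move=> n; exact: (in_idealD Q_inv).
  - by move=> n; exact: (in_idealN Q_inv).
  - by move=> n p v h; exact: in_ideal_compr.
  by exists (existT _ Y (t, r)).
pose s m := sval (cid (subE m)).
pose Y m := projT1 (s m); pose t m : hom (Y m) (f m) := (projT2 (s m)).1.
pose r m : hom (f m) (Y m) := (projT2 (s m)).2.
have rt m : r m \o t m = idm (Y m) by have [] := svalP (cid (subE m)).
have Pt m : in_ideal Q (t m) by have [] := svalP (cid (subE m)).
have Pr m n (v : hom n (f m)) : in_ideal Q v -> t m \o r m \o v = v.
  by have [_ _] := svalP (cid (subE m)); exact.
(* The data of the subfunctor are those of [f] compressed by [t] and [r]; they commute with [t]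
   because the composites lie in the ideal, where [t \o r] acts as the identity. *)
have tgm m n (h : hom m n) : t n \o (r n \o (fm f h \o t m)) = fm f h \o t m.
  by rewrite comp_assoc Pr //; exact: in_ideal_compl.
have tgl a m : t (a ▷ m) \o (r (a ▷ m) \o (fl f a m \o (idm a ▷' t m)))
    = fl f a m \o (idm a ▷' t m).
  by rewrite comp_assoc Pr //; exact: (in_ideal_lactm Q_inv).
have tgr m b : t (m ◁ b) \o (r (m ◁ b) \o (fr f m b \o (t m ◁' idm b)))
    = fr f m b \o (t m ◁' idm b).
  by rewrite comp_assoc Pr //; exact: (in_ideal_ractm Q_inv).
have := simple_sub_endofunctor rt tgm tgl tgr.
case=> //.
- move=> a m v vt; apply: (in_ideal_lactm_absorb Q_inv (Pr m)).
  by rewrite vt.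
- move=> m b v vt; apply: (in_ideal_ractm_absorb Q_inv (Pr m)).
  by rewrite vt.
- move=> t0; left=> x y v /(in_idealE Q_inv) Pv.
  by rewrite -(Pr _ _ _ Pv) t0 !comp0l.
- move=> tr1; right=> x y v; apply/(in_idealE Q_inv).
  by rewrite -(comp_idl v) -tr1 -comp_assoc; exact: in_ideal_compr.
Qed.

Local Notation act := (@tube_act R C D M IC ID IM f).

Definition tube_pure (a : fIrr IC) (b : fIrr ID) x z u w
    (h : hom #x (($a ▷ #z) ◁ $b)) (g : hom (($a ▷ #u) ◁ $b) #w) : Tube IC ID IM :=
  dsingle (F := @tube_summand R C D M IC ID IM) (i := (a, b, (x, z), (u, w)))
    (tpure h g).

Definition tube_vector x y (v : hom #x (f #y)) : tube_module IM f :=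
  dsingle (F := fun p => hom #(p.1) (f #(p.2))) (i := (x, y)) v.

Lemma tube_vector_linear x y : linear (@tube_vector x y).
Proof. exact: (@dsingle_linear _ _ (fun p => hom #(p.1) (f #(p.2))) (x, y)). Qed.

Lemma tube_act_pureE (a : fIrr IC) (b : fIrr ID) x z u w
    (h : hom #x (($a ▷ #z) ◁ $b)) (g : hom (($a ▷ #u) ◁ $b) #w) v :
  act (tube_pure h g) v = tube_vector (tube_act_pure h g (v (z, u))).
Proof.
rewrite /tube_pure /tube_vector; apply/dsumP => -[x' w']; rewrite ffunE /=.
have tlift0 p a' b' z' u' (B : _ -> _ -> hom #x' (f #w')) y :
    p != (a', b', (x', z'), (u', w')) ->
    tlift B (dsingle (F := @tube_summand R C D M IC ID IM) (i := p) y
      (a', b', (x', z'), (u', w'))) = 0.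
  by move=> ne; rewrite dsingle_other //; exact: (linear_fun0 (tlift_linear _)).
have [[ex ew]|ne] := eqVneq (x, w) (x', w'); last first.
  rewrite dsingle_other // big1 // => a' _; rewrite big1 // => b' _.
  rewrite big1 // => z' _; rewrite big1 // => u' _.
  by apply: tlift0; apply: contra ne => /eqP[_ _ -> _ _ ->].
subst x' w'; rewrite dsingle_same.
rewrite (bigD1 a) //= [X in _ + X]big1 ?addr0; last first.
  move=> a' ne; rewrite big1 // => b' _.
  rewrite big1 // => z' _; rewrite big1 // => u' _.
  by apply: tlift0; apply: contra ne => /eqP[-> _ _ _].
rewrite (bigD1 b) //= [X in _ + X]big1 ?addr0; last first.
  move=> b' ne; rewrite big1 // => z' _; rewrite big1 // => u' _.
  by apply: tlift0; apply: contra ne => /eqP[-> _ _].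
rewrite (bigD1 z) //= [X in _ + X]big1 ?addr0; last first.
  move=> z' ne; rewrite big1 // => u' _.
  by apply: tlift0; apply: contra ne => /eqP[-> _].
rewrite (bigD1 u) //= [X in _ + X]big1 ?addr0; last first.
  by move=> u' ne; apply: tlift0; apply: contra ne => /eqP[->].
by rewrite dsingle_same; exact: tlift_act_pure.
Qed.

(** If all components vanished, no simple would map nontrivially to any [f #y]. The identities of
    the [f #y] would then be zero, and by resolving [m] into simples so would that of every
    [f m]. *)
Lemma tube_module_neq0 : exists v : tube_module IM f, v <> 0.
Proof.
apply: contrapT => /forallNP all0.
have hom0 (x y : cIrr IM) (v : hom #x (f #y)) : v = 0.
  have /contrapT/dsumP/(_ (x, y)) := all0 (tube_vector v).
  by rewrite dsingle_same ffunE.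
have idm0 (y : cIrr IM) : idm (f #y) = 0.
  apply: (hom_eq0 (ucat_semisimple M) (cob_ax IM)) => x h.
  by rewrite (hom0 _ _ h) comp0r.
have [[m nz] _] := f_simple; apply: nz; apply: zero_object_idm.
have [n [s [i [p e]]]] := represents_decomp m (ucat_semisimple _) (cob_ax IM).
rewrite -fm_id -e fm_sum big1 // => k _.
by rewrite fm_comp -(comp_idl (fm f (p k))) idm0 comp0l comp0r.
Qed.

Lemma tube_invariant_subspace (W : tube_module IM f -> Prop) :
  is_invariant_subspace act W -> tube_invariant IC ID (fun x y v => W (@tube_vector x y v)).
Proof.
move=> [W0 Wlin Wact]; split.
- by move=> x y; rewrite (linear_fun0 (@tube_vector_linear x y)).
- move=> x y c v w Wv Ww; rewrite tube_vector_linear; exact: Wlin.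
- move=> a b x z u w h g v /(Wact (tube_pure h g)).
  by rewrite tube_act_pureE /tube_vector dsingle_same.
Qed.

(** The projection onto the component [(x, y)] is the action of the tube element [id_x ⊗ id_y] with
    [a = b = 𝟙], so [W] contains the components of its members. *)
Lemma invariant_subspace_component (W : tube_module IM f -> Prop) v x y :
  is_invariant_subspace act W -> W v -> W (tube_vector (v (x, y))).
Proof.
move=> [_ _ Wact] Wv.
have := Wact (tube_pure (a := None) (b := None) (unitlr #x)^† (unitlr #y)) v Wv.
by rewrite tube_act_pureE tube_act_pure_unit.
Qed.

Lemma tube_act_irreducible tau sigma :
  is_irreducible_representation (tube_one IC ID IM) (tube_mul tau sigma) act.
Proof.
split; [exact: tube_act_representation | exact: tube_module_neq0 |].
move=> W W_inv; have [W0 Wlin _] := W_inv.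
have [Q0|Q1] := tube_invariant_trivial (tube_invariant_subspace W_inv).
  left=> v Wv; apply/dsumP => -[x y]; rewrite ffunE.
  exact: Q0 (invariant_subspace_component _ _ W_inv Wv).
right=> v; rewrite (dsum_dsingle v); apply: (big_ind W) => // [u w Wu Ww|[x y] _].
  by rewrite -(scale1r u); exact: Wlin.
exact: Q1.
Qed.

End TubeIrreducible.

Theorem corollary25 (R : realType) (C D : unitary_fusion_category R)
    (M : unitary_bimodule_category C D)
    (IC : fusion_Irr C) (ID : fusion_Irr D) (IM : cat_Irr M)
    (tau : forall k a a' : fIrr IC, dual_bases (fob k) (fob a ⊗ fob a'))
    (sigma : forall s b' b : fIrr ID, dual_bases (fob s) (fob b' ⊗ fob b))
    (hM : indecomposable M)
    (dL dR : cIrr IM -> R)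
    (hL : left_quantum_dimensions IC dL)
    (hR : right_quantum_dimensions ID dR)
    (hLR : forall m, dL m = dR m)
    (f : bimodule_endofunctor M)
    (hf : simple_endofunctor f) :
  is_irreducible_representation (tube_one IC ID IM) (tube_mul tau sigma)
    (@tube_act R C D M IC ID IM f).
Proof. exact: tube_act_irreducible. Qed.
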